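(* Let $f:\mathbb{R}^d\to\mathbb{R}$ be $\ell$-smooth with $\ell>0$, let the stochastic gradient $g(x;\xi)$ be unbiased with variance bounded by $\sigma^2$, and let $f(x_0)-\min_{x\in\mathbb{R}^d}f(x)\le\Delta$. Run SGD, $x_{t+1}=x_t-\eta_t\,g(x_t;\xi_t)$, with stepsize $\eta_t=\eta/(t+1)^\alpha$, where $\eta>0$ and $0<\alpha<1$. Let $T\ge1$ be an integer. If $\eta\le1/\ell$, then $$\mathbb{E}\left[\frac1T\sum_{t=0}^{T-1}\|\nabla f(x_t)\|^2\right]\le\begin{cases}\dfrac{2}{\eta\sqrt T}\left(\Delta+\dfrac{\ell\sigma^2\eta^2}{2}(1+\log T)\right), & \alpha=1/2,\\[2mm] \dfrac{2}{\eta T^{1-\alpha}}\left(\Delta+\dfrac{\ell\sigma^2\eta^2}{2(1-2^{1-2\alpha})}\right), & 1/2<\alpha<1,\\[2mm] \dfrac{2}{\eta T^{\alpha}}\left(\dfrac{\Delta}{T^{1-2\alpha}}+\dfrac{\ell\sigma^2\eta^2}{2(1-2\alpha)}\right), & 0<\alpha<1/2.\end{cases}$$ If $\eta>1/\ell$, then with $\tau=\lceil(\eta\ell)^{1/\alpha}-1\rceil$, $$\mathbb{E}\left[\frac1T\sum_{t=0}^{T-1}\|\nabla f(x_t)\|^2\right]\le\begin{cases}\dfrac{\sqrt2\,(4e)^\tau}{\eta\sqrt{\pi\tau T}}\left[1+\ell\eta\left(1+2\sqrt\tau\right)\right]\left(\Delta+\dfrac{\ell\sigma^2\eta^2}{2}(1+\log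 T)\right), & \alpha=1/2,\\[2mm] \dfrac{2\,(4e^{2\alpha})^\tau}{\eta(2\pi\tau)^\alpha\,T^{1-\alpha}}\left[1+\ell\eta\left(1+\dfrac{\tau^{1-\alpha}}{1-\alpha}\right)\right]\left(\Delta+\dfrac{\ell\sigma^2\eta^2}{2(1-2^{1-2\alpha})}\right), & 1/2<\alpha<1,\\[2mm] \dfrac{2\,(4e^{2\alpha})^\tau}{\eta(2\pi\tau)^\alpha\,T^{\alpha}}\left[1+\ell\eta\left(1+\dfrac{\tau^{1-\alpha}}{1-\alpha}\right)\right]\left(\dfrac{\Delta}{T^{1-2\alpha}}+\dfrac{\ell\sigma^2\eta^2}{2(1-2\alpha)}\right), & 0<\alpha<1/2.\end{cases}$$
   Context: A function $f:\mathbb{R}^d\to\mathbb{R}$ is $\ell$-smooth if it is differentiable and $\|\nabla f(x_1)-\nabla f(x_2)\|\le \ell\|x_1-x_2\|$ for all $x_1,x_2\in\mathbb{R}^d$. Stochastic gradient oracle: for every $x\in\mathbb{R}^d$, $\mathbb{E}_\xi[g(x;\xi)]=\nabla f(x)$ and $\mathbb{E}_\xi\|g(x;\xi)-\nabla f(x)\|^2\le\sigma^2$. The samples $\xi_0,\xi_1,\dots$ are drawn afresh at each iteration (independently of the past) from the distribution of $\xi$. $x_0$ is a deterministic initial point, and $\log$ is the natural logarithm. *)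

(* Defs.v *)
From HB Require Import structures.
From mathcomp Require Import all_boot all_order all_algebra.
From mathcomp Require Import all_classical all_reals all_analysis.

Set Implicit Arguments.
Unset Strict Implicit.
Unset Printing Implicit Defensive.

Import Order.TTheory GRing.Theory Num.Theory.
Import numFieldNormedType.Exports.

Local Open Scope classical_set_scope.
Local Open Scope ring_scope.

(* R^d is 'rV[R]_d. The library's norm `|x| on this type is the sup norm, so
   the Euclidean norm is defined separately; both give the same topology, hence
   the same notion of differentiability. *)
Definition enorm (R : realType) (d : nat) (v : 'rV[R]_d) : R :=
  Num.sqrt (\sum_(i < d) v 0 i ^+ 2).

Definition grad (R : realType) (d : nat) (f : 'rV[R]_d -> R) (x : 'rV[R]_d) :
    'rV[R]_d :=
  \row_(i < d) 'D_(delta_mx 0 i) f x.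

Definition smooth (R : realType) (d : nat) (l : R) (f : 'rV[R]_d -> R) : Prop :=
  (forall x, differentiable f x) /\
  (forall x1 x2, enorm (grad f x1 - grad f x2) <= l * enorm (x1 - x2)).

(* R^d with its Borel sigma-algebra. *)
Definition borel_rV (R : realType) (d : nat) :=
  g_sigma_algebraType (@open 'rV[R]_d).

(* mu is the law of the sample xi, and 'E_mu is the expectation over xi.
   Joint measurability of g is what gives a meaning to the expectations along
   the iterates. The expectation of a vector is taken coordinatewise. *)
Definition stochastic_gradient (R : realType) (d : nat)
    (dS : measure_display) (S : measurableType dS) (mu : probability S R)
    (f : 'rV[R]_d -> R) (sigma : R) (g : 'rV[R]_d -> S -> 'rV[R]_d) : Prop :=
  [/\ measurable_fun [set: borel_rV R d * S]
        (fun z : borel_rV R d * S => g z.1 z.2 : borel_rV R d),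
      forall x, (forall i, mu.-integrable setT (fun s => (g x s 0 i)%R%:E)) /\
        (forall i, 'E_mu[fun s => (g x s 0 i)%R] = (grad f x 0 i)%R%:E)%E
    & forall x,
        ('E_mu[fun s => (enorm (g x s - grad f x) ^+ 2)%R]
          <= (sigma ^+ 2)%:E)%E].

Definition mutually_independent (R : realType)
    (dO : measure_display) (Omega : measurableType dO) (P : probability Omega R)
    (dS : measure_display) (S : measurableType dS)
    (xi : nat -> {RV P >-> S}) : Prop :=
  forall (J : seq nat) (A : nat -> set S), uniq J ->
    (forall i, measurable (A i)) ->
    P (\bigcap_(i in [set` J]) (xi i @^-1` A i))
      = (\prod_(i <- J) P (xi i @^-1` A i))%E.

Definition iid_samples (R : realType)
    (dO : measure_display) (Omega : measurableType dO) (P : probability Omega R)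
    (dS : measure_display) (S : measurableType dS) (mu : probability S R)
    (xi : nat -> {RV P >-> S}) : Prop :=
  mutually_independent xi /\
  (forall t (A : set S), measurable A -> distribution P (xi t) A = mu A).

Fixpoint sgd (R : realType) (d : nat) (Omega S : Type)
    (g : 'rV[R]_d -> S -> 'rV[R]_d) (step : nat -> R) (x0 : 'rV[R]_d)
    (xi : nat -> Omega -> S) (t : nat) (w : Omega) : 'rV[R]_d :=
  if t is t'.+1 then
    sgd g step x0 xi t' w - step t' *: g (sgd g step x0 xi t' w) (xi t' w)
  else x0.

Definition poly_step (R : realType) (eta alpha : R) (t : nat) : R :=
  eta / (t.+1%:R `^ alpha).

(* Extended-real valued: an upper bound by a real number also asserts
   finiteness. *)
Definition mean_sq_grad (R : realType) (d : nat)
    (dO : measure_display) (Omega : measurableType dO) (P : probability Omega R)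
    (f : 'rV[R]_d -> R) (x : nat -> Omega -> 'rV[R]_d) (T : nat) : \bar R :=
  ('E_P[fun w => (T%:R^-1 * \sum_(0 <= t < T) enorm (grad f (x t w)) ^+ 2)%R])%E.

(* Main.v *)
Require Import Defs.
From HB Require Import structures.
From mathcomp Require Import all_boot all_order all_algebra.
From mathcomp Require Import all_classical all_reals all_analysis.
From mathcomp Require Import measurable_realfun.
From mathcomp Require Import ring lra.

Set Implicit Arguments.
Unset Strict Implicit.
Unset Printing Implicit Defensive.

Import Order.TTheory GRing.Theory Num.Theory.
Import numFieldNormedType.Exports.

Local Open Scope classical_set_scope.
Local Open Scope ring_scope.

(* The descent lemma f(x+v) <= f(x) + <grad f(x), v> + l/2 |v|^2, averaged over
   the fresh sample, gives for D_t = E[f(x_t)] - min f, G_t = E|grad f(x_t)|^2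
   and steps s_t = eta/(t+1)^alpha
     D_{t+1} <= D_t + (l s_t^2/2 - s_t) G_t + l s_t^2 sigma^2/2.
   The averaging is Tonelli's theorem for the law of (x_t, xi_t), a product
   because x_t is independent of all samples of index at least t; this
   independence is propagated along the iteration by uniqueness of finite
   measures agreeing on rectangles.
   Where l s_t <= 1 the coefficient of G_t is at most -s_t/2 and the recursion
   telescopes. In the first tau steps l s_t >= 1, and G_t <= 2 l D_t bounds the
   growth of D_t by the factors (l s_t)^2, whose product is
   (eta l)^(2 tau)/(tau!)^(2 alpha); this is estimated with
   (eta l)^(1/alpha) <= tau + 1 and a weak form of Stirling's bound. *)

(** * Power sums and a weak Stirling bound *)

Lemma powR_prod (R : realType) (F : nat -> R) (a : R) (n : nat) :
  (forall t, 0 <= F t) ->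
  (\prod_(0 <= t < n) F t) `^ a = \prod_(0 <= t < n) F t `^ a.
Proof.
move=> F0; elim: n => [|n IH]; first by rewrite !big_nil powR1.
by rewrite !big_nat_recr//= powRM ?IH// prodr_ge0.
Qed.

Lemma powRN_monotone (R : realType) (q x y : R) :
  0 <= q -> 0 < x -> x <= y -> y `^ (- q) <= x `^ (- q).
Proof.
move=> q0 x0 xy; have y0 : 0 < y by exact: lt_le_trans xy.
rewrite !powRN lef_pV2 ?posrE ?powR_gt0//.
by apply: ge0_ler_powR => //; rewrite nnegrE ltW.
Qed.

(* Cauchy condensation: pairing the terms 2k and 2k+1 gives
   S(2n+1) <= 1 + 2^(1-q) S(n), and S(n) <= S(2n+1). *)
Lemma sum_powRN_le (R : realType) (q : R) (n : nat) : 1 < q ->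
  \sum_(0 <= t < n) t.+1%:R `^ (- q) <= (1 - 2 `^ (1 - q))^-1.
Proof.
move=> q1; pose S n : R := \sum_(0 <= t < n) t.+1%:R `^ (- q).
have q0 : 0 <= q by rewrite ltW// (lt_trans _ q1).
have r1 : 2 `^ (1 - q) < 1 :> R.
  rewrite /powR (@pnatr_eq0 R 2)/= expR_lt1 nmulr_rlt0 ?subr_lt0//.
  by rewrite ln_gt0// ltr1n.
have rE : 2 `^ (1 - q) = 2 * 2 `^ (- q) :> R.
  by rewrite powRD ?powRr1// ?pnatr_eq0 ?implybT.
have rec k : S k.+1 = S k + k.+1%:R `^ (- q) by rewrite /S big_nat_recr.
have step m : S m.*2.+1 <= 1 + 2 `^ (1 - q) * S m.
  elim: m => [|m IH].
    by rewrite /S big_nat1 big_nil powR1 mulr0 addr0.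
  rewrite doubleS (rec m.*2.+2) (rec m.*2.+1) (rec m) mulrDr -addrA [leRHS]addrA.
  apply: lerD; first exact: IH.
  have -> : 2 `^ (1 - q) * m.+1%:R `^ (- q)
      = m.*2.+2%:R `^ (- q) + m.*2.+2%:R `^ (- q) :> R.
    rewrite rE -mulrA -powRM// -natrM mul2n doubleS -mulr2n.
    by rewrite mulr_natl.
  by rewrite lerD2l; apply: powRN_monotone => //; rewrite ler_nat.
have mono m : S m <= S m.*2.+1.
  rewrite /S (@big_cat_nat _ _ _ m 0 m.*2.+1)//=; last first.
    by rewrite -addnn -addnS leq_addr.
  by rewrite lerDl sumr_ge0// => i _; rewrite powR_ge0.
have := le_trans (mono n) (step n); rewrite -/(S n) => h.
rewrite -[_^-1]mul1r ler_pdivlMr ?subr_gt0//.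
by rewrite mulrBr mulr1 lerBlDr mulrC.
Qed.

(** Harmonic sum against the logarithm: 1/k <= ln k - ln (k - 1) is ln (1 + u) <= u at u = -1/k. *)
Lemma sum_powRN1_le (R : realType) (n : nat) : (0 < n)%N ->
  \sum_(0 <= t < n) t.+1%:R `^ (- 1) <= 1 + ln n%:R :> R.
Proof.
case: n => // n _; elim: n => [|n IH].
  by rewrite big_nat1 powR1 ln1 addr0.
rewrite big_nat_recr//= (le_trans (lerD IH (lexx _)))//.
rewrite -addrA lerD2l powR_inv1//.
have n2 : 0 < n.+2%:R :> R by [].
have -> : n.+1%:R = n.+2%:R * (1 + (- n.+2%:R^-1)) :> R.
  by rewrite mulrDr mulr1 mulrN mulfV ?pnatr_eq0// -natr1; ring.
have u1 : -1 < - n.+2%:R^-1 :> R.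
  by rewrite ltrN2 invf_lt1// ltr1n.
rewrite lnM ?posrE//; last by rewrite -(subrr 1) ltrD2l.
by rewrite -addrA gerDl addrC -lerBrDl sub0r le_ln1Dx.
Qed.

(** Integral comparison by induction: with s = 1 - p, the step from n to n+1 reduces to r^s <= s r +
    (1 - s) at the ratio r = n/(n+1). *)
Lemma sum_powRN_lt1_le (R : realType) (p : R) (n : nat) : 0 < p -> p < 1 ->
  \sum_(0 <= t < n) t.+1%:R `^ (- p) <= n%:R `^ (1 - p) / (1 - p).
Proof.
move=> p0 p1; have s0 : 0 < 1 - p by rewrite subr_gt0.
elim: n => [|n IH].
  by rewrite big_nil divr_ge0 ?powR_ge0// ltW.
rewrite big_nat_recr//= (le_trans (lerD IH (lexx _)))//.
rewrite ler_pdivlMr// mulrDl divfK ?gt_eqF//.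
have -> : n.+1%:R `^ (- p) = n.+1%:R `^ (1 - p) / n.+1%:R :> R.
  by rewrite powRD ?pnatr_eq0 ?implybT// powRr1// mulrC mulKf ?pnatr_eq0.
set s := 1 - p in s0 *.
(* The case n = 0 is treated apart, since the ratio must be positive to have a logarithm; it reads s
   <= 1. *)
case: n {IH} => [|n].
  by rewrite powR0 ?gt_eqF// add0r powR1 divr1 mul1r /s gerBl ltW.
have u0 : 0 < n.+1%:R / n.+2%:R :> R by rewrite divr_gt0.
have {1}-> : n.+1%:R = n.+2%:R * (n.+1%:R / n.+2%:R) :> R.
  by rewrite mulrCA mulfV ?mulr1 ?pnatr_eq0.
rewrite (powRM _ _ (ltW u0))//.
(* Weighted AM-GM, obtained as convexity of exp between ln r and 0 with weight s. *)
have bern : (n.+1%:R / n.+2%:R) `^ s <= s * (n.+1%:R / n.+2%:R) + (1 - s) :> R.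
  have s01 : 0 <= s <= 1 by rewrite ltW//= /s gerBl ltW.
  have /andP[s00 s11] := s01.
  have := @convex_expR R (Itv01 s00 s11) (ln (n.+1%:R / n.+2%:R)) 0.
  rewrite !convRE /= mulr0 addr0 expR0 lnK ?posrE// mulr1.
  by rewrite /powR gt_eqF.
have e : n.+2%:R `^ s * (s * (n.+1%:R / n.+2%:R) + (1 - s))
         + n.+2%:R `^ s / n.+2%:R * s = n.+2%:R `^ s :> R.
  have -> : n.+1%:R = n.+2%:R - 1 :> R by rewrite -natr1; ring.
  have : n.+2%:R != 0 :> R by rewrite pnatr_eq0.
  by move: (n.+2%:R : R) => y y0; field.
by rewrite -[leRHS]e lerD2r ler_wpM2l ?powR_ge0.
Qed.

(* sin x >= x cos x at x = pi/8, and cos (pi/4) = 1 / sqrt 2. *)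
Lemma pi_le_17_5 (R : realType) : pi <= 17 / 5 :> R.
Proof.
have xcos (x : R) : 0 <= x -> x <= pi -> x * cos x <= sin x.
  move=> x0 xpi; pose h (y : R) := sin y - y * cos y.
  have dh (y : R) : is_derive y 1 h (y * sin y).
    by apply: is_derive_eq; rewrite /GRing.scale/=; ring.
  have h0 : h 0 = 0 by rewrite /h sin0 mul0r subr0.
  rewrite -subr_ge0 -/(h x) -h0.
  apply: (@ger0_derive1_ndecr _ h 0 pi) => //.
  - move=> y /[!in_itv]/= /andP[y0 ypi].
    rewrite derive1E (@derive_val _ _ _ _ _ _ _ (dh y)) mulr_ge0 ?ltW//.
    by apply: sin_gt0_pi; rewrite y0.
  - by apply: derivable_within_continuous => y _; have [] := dh y.
have p0 : 0 < pi :> R := pi_gt0 R.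
set x : R := pi / 8.
have x0 : 0 < x by rewrite /x; lra.
have hx : x * cos x <= sin x by apply: xcos; rewrite /x; lra.
have cx : 0 < cos x by apply: cos_gt0_pihalf; rewrite /x; lra.
have cy : 0 < cos (x + x) by apply: cos_gt0_pihalf; rewrite /x; lra.
have c4 : cos (x + x + (x + x)) = 0.
  by rewrite -cos_pihalf; congr cos; rewrite /x; lra.
have := cos2Dsin2 x; have := cos2Dsin2 (x + x).
move: c4 cy; rewrite cosD [cos (x + x)]cosD.
move: hx cx; set c := cos x; set s := sin x => hx cx c4 cy e2 e1.
have h2 : x ^+ 2 * c ^+ 2 <= s ^+ 2.
  have xc : 0 <= x * c by rewrite mulr_ge0 ?ltW.
  by rewrite -exprMn ler_sqr ?nnegrE// (le_trans xc).
suff : x <= 17 / 40 by rewrite /x; lra.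
move: cy; set C := c * c - s * s => C0.
(* C = cos (pi/4), and cos (pi/2) = 0 gives 2 C^2 = 1; 7/10 is a rational value just below 1/sqrt
   2. *)
have C7 : 7 / 10 <= C.
  rewrite -(@ler_pXn2r _ 2)// ?nnegrE ?(ltW C0) ?(ltW x0)//.
  by move: c4 e2; rewrite -/C; nra.
(* Half-angle formulas c^2 = (1 + C)/2 and s^2 = (1 - C)/2. With C >= 7/10 this yields x^2 <= 3/17 <
   (17/40)^2. *)
have h3 : x ^+ 2 * (1 + C) <= 1 - C by rewrite /C; nra.
rewrite -(@ler_pXn2r _ 2)// ?nnegrE ?(ltW C0) ?(ltW x0)//.
by have := sqr_ge0 x; nra.
Qed.

(** This is the case n = 1 of the product estimate below. It follows from e >= (17/16)^16, since
    (17/16)^32 exceeds 6.8 = 2 * 17/5. *)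
Lemma pi2_le_sqr_expR1 (R : realType) : 2 * pi <= expR 1 ^+ 2 :> R.
Proof.
have h : 17 / 16 <= expR (1 / 16) :> R.
  by have := expR_ge1Dx (1 / 16 : R); lra.
have -> : expR 1 = expR (1 / 16) ^+ 16 :> R.
  by rewrite -expRM_natl; congr expR; field.
rewrite -exprM; apply: (@le_trans _ _ ((17 / 16) ^+ 32)).
  have p : pi <= 17 / 5 :> R := @pi_le_17_5 R.
  have sq (x y z : R) (n : nat) : 0 <= y -> y <= x ^+ n -> z <= y ^+ 2 ->
      z <= x ^+ (n * 2).
    move=> y0 yx zy; rewrite exprM (le_trans zy)// ler_sqr// nnegrE//.
    exact: le_trans yx.
  have : 68 / 10 <= (17 / 16) ^+ 32 :> R.
    (* Repeated squaring: the fractions are the powers 16, 8, 4 and 2 of 17/16, rounded down. *)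
    apply: (@sq _ (261 / 100) _ 16%N); [by lra| |by lra].
    apply: (@sq _ (162 / 100) _ 8%N); [by lra| |by lra].
    apply: (@sq _ (1274 / 1000) _ 4%N); [by lra| |by lra].
    apply: (@sq _ (11289 / 10000) _ 2%N); [by lra| |by lra].
    by lra.
  by move: ((17 / 16) ^+ 32) => z; lra.
by apply: lerXn2r => //; rewrite nnegrE; [lra|exact: expR_ge0].
Qed.

(* A weak form of Stirling's bound n! >= sqrt (2 pi n) (n / e)^n: the ratio of
   consecutive products is (1 + 1/(n+1))^(2(n+1)) <= e^2. *)
Lemma prod_ratio_le (R : realType) (n : nat) : (0 < n)%N ->
  2 * pi * n%:R * \prod_(0 <= t < n) (n.+1%:R / t.+1%:R) ^+ 2
    <= (4 * expR 1 ^+ 2) ^+ n :> R.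
Proof.
case: n => // n _; elim: n => [|n IH].
  rewrite big_nat1 expr1 mulr1 divr1.
  by have := @pi2_le_sqr_expR1 R; lra.
pose Q k : R := \prod_(0 <= t < k) (k.+1%:R / t.+1%:R) ^+ 2.
rewrite -/(Q n.+2) -/(Q n.+1) in IH *.
have Q0 : 0 <= Q n.+1 by apply: prodr_ge0 => i _; exact: sqr_ge0.
(* Raising the numerator from k+1 to k+2 multiplies each of the k old factors by ((k+2)/(k+1))^2;
   the new factor is one more copy. *)
have QS k : Q k.+1 = Q k * ((k.+2%:R / k.+1%:R) ^+ k.+1) ^+ 2.
  rewrite /Q big_nat_recr//= [(_ ^+ k.+1) ^+ 2]exprAC [X in _ = _ * X]exprSr [RHS]mulrA; congr (_ * _).
  have -> : ((k.+2%:R / k.+1%:R) ^+ 2) ^+ k = \prod_(0 <= t < k)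
      ((k.+2%:R / k.+1%:R) ^+ 2) :> R by rewrite prodr_const_nat subn0.
  rewrite -big_split/=; apply: eq_bigr => i _; rewrite -exprMn; congr (_ ^+ 2).
  have : k.+1%:R != 0 :> R by rewrite pnatr_eq0.
  have : i.+1%:R != 0 :> R by rewrite pnatr_eq0.
  move: (k.+1%:R : R) (k.+2%:R : R) (i.+1%:R : R) => a b c c0 a0.
  by field; rewrite a0.
have e1 : (n.+3%:R / n.+2%:R) ^+ n.+2 <= expR 1 :> R.
  have -> : expR 1 = expR n.+2%:R^-1 ^+ n.+2 :> R.
    by rewrite -expRM_natl mulfV ?pnatr_eq0.
  apply: lerXn2r; rewrite ?nnegrE ?divr_ge0 ?expR_ge0//.
  apply: le_trans (expR_ge1Dx _).
  by rewrite -[n.+3%:R]natr1 mulrDl mulfV ?pnatr_eq0// mul1r.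
have e2 : ((n.+3%:R / n.+2%:R) ^+ n.+2) ^+ 2 <= expR 1 ^+ 2 :> R.
  by apply: lerXn2r => //; rewrite nnegrE ?exprn_ge0 ?divr_ge0 ?expR_ge0.
rewrite QS [leRHS]exprS.
have p0 : 0 <= pi :> R := pi_ge0 R.
(* The linear prefactor at most doubles, so one step costs at most 2 e^2, within the allowed 4
   e^2. *)
have le2 : n.+2%:R <= 2 * n.+1%:R :> R.
  by rewrite -natrM ler_nat mul2n -addnn addSn ltnS addnS ltnS leq_addr.
apply: (@le_trans _ _ (4 * expR 1 ^+ 2 * (2 * pi * n.+1%:R * Q n.+1))); last first.
  by rewrite ler_wpM2l// mulr_ge0// exprn_ge0// expR_ge0.
have : n.+2%:R * ((n.+3%:R / n.+2%:R) ^+ n.+2) ^+ 2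
    <= 2 * n.+1%:R * expR 1 ^+ 2 :> R.
  by apply: ler_pM => //; rewrite exprn_ge0 ?exprn_ge0 ?divr_ge0.
set a := _ ^+ 2; set b := expR 1 ^+ 2 => ab.
apply: (@le_trans _ _ (2 * pi * Q n.+1 * (n.+2%:R * a))).
  rewrite le_eqVlt; apply/orP; left; apply/eqP.
  by move: (pi : R) (Q n.+1) (n.+2%:R : R) => p q r; ring.
apply: (@le_trans _ _ (2 * pi * Q n.+1 * (2 * n.+1%:R * b))).
  by apply: ler_wpM2l => //; rewrite mulr_ge0// mulr_ge0.
have b0 : 0 <= b by exact: sqr_ge0.
have : 0 <= pi * Q n.+1 * n.+1%:R * b by rewrite !mulr_ge0.
by move: (pi : R) (Q n.+1) (n.+1%:R : R) => p q r; lra.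
Qed.

(** * Descent for smooth functions *)

Definition inner (R : realType) (d : nat) (u v : 'rV[R]_d) : R :=
  \sum_(i < d) u 0 i * v 0 i.

Lemma enorm_sqr (R : realType) (d : nat) (v : 'rV[R]_d) :
  enorm v ^+ 2 = inner v v.
Proof.
rewrite /enorm sqr_sqrtr /inner; first by apply: eq_bigr => i _; rewrite expr2.
by apply: sumr_ge0 => i _; exact: sqr_ge0.
Qed.

Lemma enorm_ge0 (R : realType) (d : nat) (v : 'rV[R]_d) : 0 <= enorm v.
Proof. exact: sqrtr_ge0. Qed.

Lemma ler_coord_enorm (R : realType) (d : nat) (v : 'rV[R]_d) (i : 'I_d) :
  `|v 0 i| <= enorm v.
Proof.
rewrite -sqrtr_sqr; apply: ler_wsqrtr.
by rewrite (bigD1 i)//= lerDl sumr_ge0// => j _; exact: sqr_ge0.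
Qed.

Lemma innerDl (R : realType) (d : nat) (u v w : 'rV[R]_d) :
  inner (u + v) w = inner u w + inner v w.
Proof. by rewrite /inner -big_split; apply: eq_bigr => i _; rewrite mxE mulrDl. Qed.

Lemma innerZl (R : realType) (d : nat) (a : R) (u v : 'rV[R]_d) :
  inner (a *: u) v = a * inner u v.
Proof. by rewrite /inner mulr_sumr; apply: eq_bigr => i _; rewrite mxE mulrA. Qed.

Lemma innerC (R : realType) (d : nat) (u v : 'rV[R]_d) : inner u v = inner v u.
Proof. by apply: eq_bigr => i _; rewrite mulrC. Qed.

Lemma innerNl (R : realType) (d : nat) (u v : 'rV[R]_d) :
  inner (- u) v = - inner u v.
Proof. by rewrite -scaleN1r innerZl mulN1r. Qed.

Lemma innerBl (R : realType) (d : nat) (u v w : 'rV[R]_d) :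
  inner (u - v) w = inner u w - inner v w.
Proof. by rewrite innerDl innerNl. Qed.

Lemma enorm_sqrZ (R : realType) (d : nat) (a : R) (u : 'rV[R]_d) :
  enorm (a *: u) ^+ 2 = a ^+ 2 * enorm u ^+ 2.
Proof. by rewrite !enorm_sqr innerZl innerC innerZl; ring. Qed.

(** Expansion of |u - c v|^2 >= 0. This form of Young's inequality stands in for Cauchy-Schwarz:
    when |u| <= c |v| and c > 0, it gives <u, v> <= c |v|^2. *)
Lemma inner_le_sqr (R : realType) (d : nat) (c : R) (u v : 'rV[R]_d) :
  2 * (c * inner u v) <= enorm u ^+ 2 + c ^+ 2 * enorm v ^+ 2.
Proof.
rewrite -subr_ge0.
have -> : enorm u ^+ 2 + c ^+ 2 * enorm v ^+ 2 - 2 * (c * inner u v)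
    = enorm (u - c *: v) ^+ 2.
  rewrite !enorm_sqr innerBl innerZl ![inner _ (u - _)]innerC !innerBl !innerZl.
  by rewrite (innerC v u); ring.
exact: sqr_ge0.
Qed.

(** [grad] collects partial derivatives only; differentiability makes the derivative linear in the
    direction, so they determine it along every [v]. *)
Lemma derive_inner_grad (R : realType) (d : nat) (f : 'rV[R]_d -> R) x v :
  differentiable f x -> 'D_v f x = inner (grad f x) v.
Proof.
move=> df; rewrite deriveE// {1}(row_sum_delta v) linear_sum.
apply: eq_bigr => i _; rewrite linearZ/= mxE deriveE//.
by rewrite /GRing.scale/= mulrC.
Qed.

Lemma is_derive_line (R : realType) (d : nat) (f : 'rV[R]_d -> R)
    (x v : 'rV[R]_d) (s : R) : (forall x, differentiable f x) ->
  is_derive s 1 (fun s => f (x + s *: v)) (inner (grad f (x + s *: v)) v).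
Proof.
move=> df; rewrite -derive_inner_grad//.
have dv : derivable f (x + s *: v) v by exact: diff_derivable.
have E : (fun h : R => h^-1 *: (((fun s => f (x + s *: v)) \o shift s) (h *: 1)
      - f (x + s *: v)))
    = (fun h : R => h^-1 *: ((f \o shift (x + s *: v)) (h *: v) - f (x + s *: v))).
  apply/funext => h /=; congr (_ *: (f _ - _)).
  by rewrite [h *: 1]mulr1 scalerDl addrCA.
by apply: DeriveDef; [rewrite /derivable E|rewrite /derive E].
Qed.

(** Along the segment from x to x + v, [h] is the quadratic upper model minus f. It vanishes at 0
    and is nondecreasing because the gradient is Lipschitz. *)
Lemma smooth_descent (R : realType) (d : nat) (l : R) (f : 'rV[R]_d -> R)
    (x v : 'rV[R]_d) : 0 < l -> smooth l f ->
  f (x + v) <= f x + inner (grad f x) v + l / 2 * enorm v ^+ 2.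
Proof.
move=> l0 [df lip].
pose h (s : R) := f x + s * inner (grad f x) v + s ^+ 2 * (l / 2 * enorm v ^+ 2)
  - f (x + s *: v).
have dh (s : R) : is_derive s 1 h (inner (grad f x) v
    + 2 * s * (l / 2 * enorm v ^+ 2) - inner (grad f (x + s *: v)) v).
  have := is_derive_line x v s df => dline.
  apply: is_derive_eq; rewrite /GRing.scale/=; ring.
have h0 : h 0 = 0 by rewrite /h !scale0r addr0; ring.
suff : 0 <= h 1 by rewrite /h scale1r; lra.
rewrite -h0; apply: (@ger0_derive1_ndecr _ h 0 1) => //.
- move=> s /[!in_itv]/= /andP[s0 s1].
  rewrite derive1E (@derive_val _ _ _ _ _ _ _ (dh s)).
  have ls0 : 0 < l * s by rewrite mulr_gt0.
  have glip : enorm (grad f (x + s *: v) - grad f x) ^+ 2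
      <= (l * s) ^+ 2 * enorm v ^+ 2.
    apply: (@le_trans _ _ ((l * enorm (s *: v)) ^+ 2)).
      rewrite ler_sqr ?nnegrE ?enorm_ge0 ?mulr_ge0 ?enorm_ge0 ?(ltW l0)//.
      by have := lip (x + s *: v) x; rewrite addrAC subrr add0r.
    by rewrite exprMn enorm_sqrZ mulrA exprMn.
  (* With c = l s both squares are at most (l s)^2 |v|^2. Dividing by 2 l s, positive at interior
     points, bounds the inner product by l s |v|^2. *)
  have := inner_le_sqr (l * s) (grad f (x + s *: v) - grad f x) v.
  rewrite innerBl => /le_trans -/(_ _ (lerD glip (lexx _))).
  set A := inner _ _; set B := inner _ _; set N := enorm v ^+ 2 => H.
  suff : A - B <= l * s * N by lra.
  rewrite -(ler_pM2l ls0); lra.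
- by apply: derivable_within_continuous => s _; have [] := dh s.
Qed.

(** A gradient step of length 1/l lowers f by at least |grad f x|^2 / (2 l), yet cannot go below
    m. *)
Lemma smooth_sqr_grad_le (R : realType) (d : nat) (l : R) (f : 'rV[R]_d -> R)
    (x : 'rV[R]_d) (m : R) : 0 < l -> smooth l f -> (forall y, m <= f y) ->
  enorm (grad f x) ^+ 2 <= 2 * l * (f x - m).
Proof.
move=> l0 sf hm.
have := le_trans (hm _) (smooth_descent x (- l^-1 *: grad f x) l0 sf).
rewrite enorm_sqrZ innerC innerZl -enorm_sqr.
set G := enorm _ ^+ 2 => H.
have -> : G = 2 * l * (l^-1 * G - l / 2 * ((- l^-1) ^+ 2 * G)).
  by field; rewrite gt_eqF.
by rewrite ler_wpM2l ?mulr_ge0 ?(ltW l0)//; lra.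
Qed.

(** * Borel measurability in R^d *)

Section borel_vectors.
Context (R : realType) (d : nat).
Implicit Types (f : 'rV[R]_d -> R).

Lemma measurable_continuous_rV f : continuous f ->
  measurable_fun [set: borel_rV R d] (f : borel_rV R d -> R).
Proof.
move=> cf; apply: (measurability _ (RGenOInfty.measurableE R)).
move=> _ [_ [a ->] <-]; rewrite setTI.
by apply: sub_sigma_algebra; apply: open_comp => // x _; exact: cf.
Qed.

(* The norm balls of R^d are the open cubes, so that the cubes with rational
   centres and radii form a countable basis. *)
Lemma measurable_fun_rV (dT : measure_display) (T : measurableType dT)
    (h : T -> 'rV[R]_d) : (forall i, measurable_fun setT (fun w => h w 0 i)) ->
  measurable_fun setT (h : T -> borel_rV R d).
Proof.
move=> mh.
have mball (q : 'rV[R]_d) (e : R) : measurable (h @^-1` ball q e).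
  have [e0|e0] := ltP 0 e; last first.
    rewrite (_ : h @^-1` _ = set0)//; apply/seteqP; split => // w [].
    by rewrite ltNge e0.
  rewrite (_ : h @^-1` _ = \bigcap_(i in [set: 'I_d])
      ((fun w => h w 0 i) @^-1` ball (q 0 i) e)).
    apply: fin_bigcap_measurable => // i _.
    rewrite -[X in measurable X]setTI; apply: mh => //.
    by apply: open_measurable; exact: ball_open.
  apply/seteqP; split => w /=; first by move=> [_ hw] i _; exact: hw.
  by move=> hw; split => // i j; rewrite ord1; exact: hw.
move=> _ B mB; move: B mB.
apply: (@measurability _ _ _ (borel_rV R d) setT h (@open 'rV[R]_d)) => //.
move=> _ [U oU <-]; rewrite setTI.
pose c (p : 'rV[rat]_d * nat) := ball (map_mx ratr p.1 : 'rV[R]_d) p.2.+1%:R^-1.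
rewrite (_ : h @^-1` U =
    \bigcup_(p in [set p | c p `<=` U]) (h @^-1` c p)); last first.
  apply/seteqP; split => [w Uw|w [p pU cpw]]; last exact: (pU _ cpw).
  have /nbhs_ballP[e e0 eU] : nbhs (h w) U by exact: open_nbhs_nbhs.
  (* The radius 1/(n+1) is at most e/2, so a cube of this radius containing [h w] lies inside
     [ball (h w) e]. *)
  pose n := Num.truncn (2 / e).
  have n2 : n.+1%:R^-1 + n.+1%:R^-1 <= e :> R.
    have : 2 / e <= n.+1%:R by rewrite ltW// truncnS_gt.
    rewrite ler_pdivrMr// => ne.
    by rewrite -mulr2n -[leLHS]mulr_natl ler_pdivrMr// mulrC.
  have n0 : 0 < n.+1%:R^-1 :> R by rewrite invr_gt0.
  have qP i : exists q : rat, ball (h w 0 i) n.+1%:R^-1 (ratr q).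
    have /rat_in_itvoo[q /[!inE]] : h w 0 i - n.+1%:R^-1 < h w 0 i + n.+1%:R^-1.
      by rewrite ltrD2l gtrN.
    by move=> qi; exists q; rewrite ball_itv/=.
  pose q := \row_i projT1 (cid (qP i)).
  have cq : c (q, n) (h w).
    split => // i j; rewrite ord1 mxE mxE; apply: ball_sym.
    exact: (projT2 (cid (qP j))).
  exists (q, n) => // v cv; apply: eU; apply: (le_ball n2).
  exact: ball_triangle (ball_sym cq) cv.
rewrite bigcup_mkcond; apply: countable_bigcupT_measurable => // p.
by case: ifPn => // _; exact: mball.
Qed.

End borel_vectors.

(** * Fresh samples *)

(** Measurable rectangles are stable under intersection and generate the product sigma-algebra; as
    [m1] is finite, the constant sequence [setT] exhausts the space. *)
Lemma finite_measure_prod_unique (R : realType) (d1 d2 : measure_display)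
    (T1 : measurableType d1) (T2 : measurableType d2)
    (m1 m2 : {measure set (T1 * T2) -> \bar R}) :
  (m1 setT < +oo)%E ->
  (forall A B, measurable A -> measurable B -> m1 (A `*` B) = m2 (A `*` B)) ->
  forall C, measurable C -> m1 C = m2 C.
Proof.
move=> m1oo m12 C mC.
pose G : set (set (T1 * T2)) :=
  [set C | exists A, measurable A /\ exists B, measurable B /\ C = A `*` B].
apply: (measure_unique G (fun=> setT)) => //.
- rewrite measurable_prod_measurableType //; congr (<<s _ >>).
  rewrite predeqE; split => [[A mA [B mB <-]]|[A [mA [B [mB ->]]]]].
    by exists A; split => //; exists B.
  by exists A => //; exists B.
- move=> _ _ [X1 [mX1 [X2 [mX2 ->]]]] [Y1 [mY1 [Y2 [mY2 ->]]]].
  rewrite -setXI; exists (X1 `&` Y1); split; first exact: measurableI.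
  by exists (X2 `&` Y2); split => //; exact: measurableI.
- by move=> _; exists setT; split => //; exists setT; rewrite setXTT.
- by rewrite bigcup_const//; exists 0%N.
- by move=> _ [A [mA [B [mB ->]]]]; exact: m12.
Qed.

Section fresh_samples.
Context (R : realType) (dO dE dS : measure_display)
  (Omega : measurableType dO) (P : probability Omega R)
  (E : measurableType dE) (S : measurableType dS).
Variables (mu : probability S R) (xi : nat -> {RV P >-> S}).

Definition sample_event (J : seq nat) (A : nat -> set S) : set Omega :=
  \bigcap_(i in [set` J]) (xi i @^-1` A i).

(** Independence from every finite family of samples of index at least t, not from [xi t] alone: an
    iteration consumes [xi t], and the claim about the later samples must survive it. *)
Definition indep_of_future (X : Omega -> E) (t : nat) : Prop :=
  forall (B : set E) (J : seq nat) (A : nat -> set S),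
    measurable B -> uniq J -> all (leq t) J -> (forall i, measurable (A i)) ->
    P (X @^-1` B `&` sample_event J A) = (P (X @^-1` B) * P (sample_event J A))%E.

Hypothesis hxi : iid_samples mu xi.

Lemma measurable_sample_event J A : (forall i, measurable (A i)) ->
  measurable (sample_event J A).
Proof.
move=> mA; apply: fin_bigcap_measurable => [|i _]; first exact: finite_seq.
by rewrite -[X in measurable X]setTI; exact: measurable_funP.
Qed.

Lemma indep_of_future_cst x0 t : indep_of_future (fun=> x0) t.
Proof.
move=> B J A mB uJ aJ mA; have [Bx|nBx] := pselect (B x0).
  rewrite (_ : _ @^-1` B = setT); last by apply/seteqP; split.
  by rewrite setTI probability_setT mul1e.
rewrite (_ : _ @^-1` B = set0); first by rewrite set0I measure0 mul0e.
by apply/seteqP; split.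
Qed.

Lemma sample_event_cons t J A (D : set S) : t \notin J ->
  sample_event (t :: J) (fun i => if i == t then D else A i)
    = xi t @^-1` D `&` sample_event J A.
Proof.
move=> tJ; apply/seteqP; split => [w h|w [h1 h2] i].
  split; first by have := h t; rewrite /= inE !eqxx/=; exact.
  move=> i /= iJ; have := h i; rewrite /= inE iJ orbT => /(_ isT).
  by case: eqP => // it; move: iJ; rewrite it (negPf tJ).
rewrite /= inE => /orP[/eqP ->|iJ] /=; first by rewrite eqxx.
case: eqP => [it|_]; first by move: iJ; rewrite it (negPf tJ).
exact: h2.
Qed.

Lemma mutually_independent_cons t J A (D : set S) : uniq (t :: J) ->
  measurable D -> (forall i, measurable (A i)) ->
  P (xi t @^-1` D `&` sample_event J A)
    = (P (xi t @^-1` D) * P (sample_event J A))%E.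
Proof.
move=> /[dup] utJ /= /andP[tJ uJ] mD mA; have [ind _] := hxi.
rewrite -sample_event_cons// /sample_event ind//; last by move=> i; case: ifP.
rewrite ind// big_cons eqxx; congr (_ * _)%E.
apply: eq_big_seq => i iJ; case: eqP => // it.
by move: iJ; rewrite it (negPf tJ).
Qed.

(** The event on [xi t] and those on [J] together form an event on samples from t on, so [X] splits
    off first; mutual independence then separates [xi t] from [J]. *)
Lemma indep_of_future_pair (X : Omega -> E) t (B : set E) J A (D : set S) :
  indep_of_future X t -> measurable B -> measurable D ->
  uniq J -> all (leq t.+1) J -> (forall i, measurable (A i)) ->
  P (X @^-1` B `&` xi t @^-1` D `&` sample_event J A)
    = (P (X @^-1` B) * P (xi t @^-1` D) * P (sample_event J A))%E.
Proof.
move=> indX mB mD uJ aJ mA.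
have tJ : t \notin J by apply/negP => /(allP aJ); rewrite ltnn.
have utJ : uniq (t :: J) by rewrite /= tJ.
rewrite -setIA -sample_event_cons// indX//.
- by rewrite sample_event_cons// mutually_independent_cons// muleA.
- by rewrite /= leqnn; apply: sub_all aJ => i; exact: ltnW.
- by move=> i; case: ifP.
Qed.

Lemma sample_event_nil A : sample_event [::] A = setT.
Proof. by apply/seteqP; split. Qed.

(** For a fixed future event F, the maps C |-> P(Z in C, F) and C |-> P(F) P(Z in C), where Z = (X,
    xi t), are finite measures agreeing on rectangles. They are compared at the preimage of B under
    [h]. *)
Lemma indep_of_future_step (X : Omega -> E) t (h : E * S -> E) :
  measurable_fun setT X -> measurable_fun setT h ->
  indep_of_future X t -> indep_of_future (fun w => h (X w, xi t w)) t.+1.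
Proof.
move=> mX mh indX B J A mB uJ aJ mA.
pose Z w := (X w, xi t w).
have mZ : measurable_fun setT Z by exact: measurable_fun_pair.
pose F := sample_event J A.
have mF : measurable F by exact: measurable_sample_event.
(* [mscale] scales by a nonnegative real, so the finite value P F is passed through [fine]. *)
pose c : {nonneg R} := NngNum (fine_ge0 (measure_ge0 P F)).
have PF : P F = c%:num%:E by rewrite /= fineK// fin_num_measure.
pose ZP : {mfun Omega >-> (E * S)%type} := HB.pack Z (isMeasurableFun.Build _ _ _ _ Z mZ).
have := @finite_measure_prod_unique _ _ _ _ _
  (pushforward (mrestr P mF) ZP) (mscale c (pushforward P ZP)).
move=> /(_ mZ mZ _ _ (h @^-1` B)) H.
rewrite -/F PF muleC; apply: H.
- change (P (setT `&` F) < +oo)%E.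
  by rewrite setTI (le_lt_trans (probability_le1 _ _)) ?ltry.
- move=> B' D mB' mD; rewrite /mscale.
  change (P (X @^-1` B' `&` xi t @^-1` D `&` F)
    = c%:num%:E * P (X @^-1` B' `&` xi t @^-1` D))%E.
  rewrite indep_of_future_pair// -/F PF muleC; congr (_ * _)%E.
  have := @indep_of_future_pair X t B' [::] A D indX mB' mD isT isT mA.
  by rewrite sample_event_nil setIT probability_setT mule1.
- by rewrite -[X in measurable X]setTI; exact: mh.
Qed.

(** The joint law of (X, xi t) is the product of the law of X and [mu], by uniqueness of the product
    measure on rectangles. Tonelli's theorem then integrates the sample first. *)
Lemma expectation_fresh_sample (X : Omega -> E) t (phi : E * S -> \bar R) :
  measurable_fun setT X -> indep_of_future X t ->
  measurable_fun setT phi -> (forall z, 0 <= phi z)%E ->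
  (\int[P]_w phi (X w, xi t w) = \int[P]_w \int[mu]_s phi (X w, s))%E.
Proof.
move=> mX indX mphi phi0.
pose XP : {mfun Omega >-> E} := HB.pack X (isMeasurableFun.Build _ _ _ _ X mX).
pose Z w := (X w, xi t w).
have mZ : measurable_fun setT Z by exact: measurable_fun_pair.
pose ZP : {mfun Omega >-> (E * S)%type} := HB.pack Z (isMeasurableFun.Build _ _ _ _ Z mZ).
rewrite -(@ge0_integral_distribution _ _ _ _ _ P ZP phi)//.
have -> : (\int[distribution P ZP]_z phi z
    = \int[distribution P XP \x mu]_z phi z)%E.
  apply: eq_measure_integral => C mC _; apply/esym/product_measure_unique => //.
  move=> B D mB mD; have [_ law] := hxi.
  transitivity (P (X @^-1` B) * P (xi t @^-1` D))%E; last first.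
    by congr (_ * _)%E; exact: law.
  change (P (X @^-1` B `&` xi t @^-1` D) = P (X @^-1` B) * P (xi t @^-1` D))%E.
  have := @indep_of_future_pair X t B [::] (fun=> setT) D indX mB mD isT isT (fun=> measurableT).
  by rewrite sample_event_nil setIT probability_setT mule1.
rewrite fubini_tonelli1//.
rewrite (@ge0_integral_distribution _ _ _ _ _ P XP)//.
- exact: measurable_fun_fubini_tonelli_F.
- by move=> x; exact: integral_ge0.
Qed.

End fresh_samples.

(** * The SGD recursion in expectation *)

Section smooth_measurability.
Context (R : realType) (d : nat) (l : R) (f : 'rV[R]_d -> R).
Hypotheses (l0 : 0 < l) (sf : smooth l f).

(** The crude constant d+1 replaces sqrt d; it is nonzero even in dimension 0, so it can be divided
    by. *)
Lemma enorm_le_coord (v : 'rV[R]_d) (e : R) : 0 <= e ->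
  (forall i, `|v 0 i| <= e) -> enorm v <= d.+1%:R * e.
Proof.
move=> e0 ve; have de0 : 0 <= d.+1%:R * e by rewrite mulr_ge0.
rewrite -[leRHS]ger0_norm// -sqrtr_sqr; apply: ler_wsqrtr.
apply: (@le_trans _ _ (\sum_(i < d) e ^+ 2)).
  by apply: ler_sum => i _; rewrite -real_normK ?num_real// lerXn2r ?nnegrE.
rewrite sumr_const card_ord -[leLHS]mulr_natl exprMn ler_wpM2r ?sqr_ge0//.
by rewrite -natrX ler_nat (leq_trans (leqnSn d))// expnS leq_pmulr// expn_gt0.
Qed.

Lemma continuous_smooth : continuous f.
Proof. by move=> x; apply: differentiable_continuous; have [df _] := sf. Qed.

Lemma continuous_grad_coord i : continuous (fun x => grad f x 0 i).
Proof.
move=> x s /= /(nbhs_ballP (grad f x 0 i))[e /= e0 es].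
(* On the sup-norm ball of radius r the gradient varies by at most l (d+1) r = e/2. *)
set r := e / (l * d.+1%:R) / 2.
have r0 : 0 < r by rewrite !divr_gt0 ?mulr_gt0.
apply/nbhs_ballP; exists r => //= y [_ xy]; apply: es.
apply: (@le_lt_trans _ _ (enorm (grad f x - grad f y))).
  have <- : (grad f x - grad f y) 0 i = grad f x 0 i - grad f y 0 i by rewrite !mxE.
  exact: ler_coord_enorm.
have [_ lip] := sf; apply: (le_lt_trans (lip x y)).
have /enorm_le_coord -/(_ (ltW r0)) h : forall i, `|(x - y) 0 i| <= r.
  by move=> j; rewrite !mxE; apply: ltW; exact: xy.
rewrite (le_lt_trans (ler_wpM2l (ltW l0) h))// mulrA /r mulrA mulrCA mulfV ?mulr1.
  by rewrite ltr_pdivrMr// ltr_pMr// ltr1n.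
by rewrite gt_eqF// mulr_gt0.
Qed.

Lemma measurable_sqr_enorm (dT : measure_display) (T : measurableType dT)
    (h : T -> 'rV[R]_d) : (forall i, measurable_fun setT (fun w => h w 0 i)) ->
  measurable_fun setT (fun w => enorm (h w) ^+ 2).
Proof.
move=> mh; rewrite (_ : (fun w => _) = (fun w => \sum_(i < d) h w 0 i * h w 0 i)).
  by apply: measurable_sum => i; apply: measurable_funM; exact: mh.
by apply/funext => w; rewrite enorm_sqr.
Qed.

Lemma measurable_sqr_grad :
  measurable_fun [set: borel_rV R d] (fun x : borel_rV R d => enorm (grad f x) ^+ 2).
Proof.
apply: measurable_sqr_enorm => i.
by apply: measurable_continuous_rV; exact: continuous_grad_coord.
Qed.

Lemma measurable_coord_rV (dT : measure_display) (T : measurableType dT)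
    (h : T -> borel_rV R d) i : measurable_fun setT h ->
  measurable_fun setT (fun w => (h w : 'rV[R]_d) 0 i).
Proof.
move=> mh; have mc : measurable_fun [set: borel_rV R d]
    (fun v : borel_rV R d => (v : 'rV[R]_d) 0 i).
  by apply: measurable_continuous_rV; exact: coord_continuous.
exact: (measurableT_comp mc mh).
Qed.

End smooth_measurability.

(** * The iterates, their independence of later samples, and the one-step inequality *)

Section sgd_recursion.
Context (R : realType) (d : nat) (dS dO : measure_display)
  (S : measurableType dS) (mu : probability S R)
  (Omega : measurableType dO) (P : probability Omega R)
  (f : 'rV[R]_d -> R) (l sigma : R) (g : 'rV[R]_d -> S -> 'rV[R]_d)
  (xi : nat -> {RV P >-> S}) (x0 xmin : 'rV[R]_d) (step : nat -> R).
Hypotheses (l0 : 0 < l) (sf : smooth l f)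
  (hg : stochastic_gradient mu f sigma g) (hxi : iid_samples mu xi)
  (hmin : forall x, f xmin <= f x).

Let x := sgd g step x0 xi.
Let gap (y : 'rV[R]_d) := f y - f xmin.
Let sqgrad (y : 'rV[R]_d) := enorm (grad f y) ^+ 2.

Lemma measurable_sgd_step (a : R) :
  measurable_fun [set: borel_rV R d * S]
    (fun z : borel_rV R d * S => (z.1 : 'rV[R]_d) - a *: g z.1 z.2 : borel_rV R d).
Proof.
have [mg _ _] := hg.
apply: measurable_fun_rV => i.
rewrite (_ : (fun _ => _) = (fun z : borel_rV R d * S =>
    (z.1 : 'rV[R]_d) 0 i - a * g z.1 z.2 0 i)); last first.
  by apply/funext => z; rewrite !mxE.
apply: measurable_funB; first exact: measurable_coord_rV.
by apply: measurable_funM => //; exact: measurable_coord_rV mg.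
Qed.

Lemma measurable_sgd t :
  measurable_fun setT (x t : Omega -> borel_rV R d).
Proof.
elim: t => [|t IH]; first exact: measurable_cst.
have mZ : measurable_fun setT
    (fun w => (x t w : borel_rV R d, xi t w)) by exact: measurable_fun_pair.
exact: (measurableT_comp (measurable_sgd_step (step t)) mZ).
Qed.

Lemma indep_sgd t : indep_of_future xi (x t : Omega -> borel_rV R d) t.
Proof.
elim: t => [|t IH]; first exact: indep_of_future_cst.
exact: (indep_of_future_step hxi (measurable_sgd t) (measurable_sgd_step (step t)) IH).
Qed.

Lemma measurable_gap : measurable_fun [set: borel_rV R d] (gap : borel_rV R d -> R).
Proof.
apply: measurable_funB => //.
by apply: measurable_continuous_rV; exact: continuous_smooth sf.
Qed.

Lemma gap_ge0 y : 0 <= gap y. Proof. by rewrite subr_ge0. Qed.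

Lemma measurable_oracle y :
  measurable_fun setT (g y : S -> borel_rV R d).
Proof.
have [mg _ _] := hg.
have mp : measurable_fun setT (fun s : S => (y : borel_rV R d, s)).
  exact: measurable_fun_pair.
exact: (measurableT_comp mg mp).
Qed.

Lemma integrable_inner_oracle u y :
  mu.-integrable setT (fun s => (inner u (g y s))%:E).
Proof.
have [_ /(_ y)[ig _] _] := hg.
rewrite (_ : (fun _ => _) = (fun s => \sum_(i < d) (u 0 i)%:E * (g y s 0 i)%:E)%E).
  by apply: integrable_sum => // i _; apply: integrableZl.
by apply/funext => s; rewrite /inner -sumEFin.
Qed.

Lemma integral_inner_oracle u y :
  (\int[mu]_s (inner u (g y s))%:E = (inner u (grad f y))%:E)%E.
Proof.
have [_ /(_ y)[ig Eg] _] := hg.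
transitivity (\int[mu]_s (\sum_(i < d) (u 0 i)%:E * (g y s 0 i)%:E))%E.
  by apply: eq_integral => s _; rewrite /inner -sumEFin.
rewrite integral_sum//; last by move=> i; exact: integrableZl.
rewrite /inner -sumEFin; apply: eq_bigr => i _.
rewrite integralZl// EFinM; congr (_ * _)%E.
by rewrite -Eg unlock.
Qed.

Lemma integrable_oracle_variance y :
  mu.-integrable setT (fun s => (enorm (g y s - grad f y) ^+ 2)%:E).
Proof.
have [_ _ /(_ y) vg] := hg; apply/integrableP; split.
  apply/measurable_EFinP; apply: measurable_sqr_enorm => i.
  rewrite (_ : (fun _ => _) = (fun s => g y s 0 i - grad f y 0 i)).
    by apply: measurable_funB => //; exact: measurable_coord_rV (measurable_oracle y).
  by apply/funext => s; rewrite !mxE.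
apply: le_lt_trans (ltry (sigma ^+ 2)); apply: le_trans vg.
rewrite unlock le_eqVlt; apply/orP; left; apply/eqP.
by apply: eq_integral => s _; rewrite gee0_abs// lee_fin sqr_ge0.
Qed.

(** The descent lemma along -a g, with |g|^2 = |g - grad|^2 + 2 <grad, g> - |grad|^2. The resulting
    bound [bd] is affine in [I] and [W], whose means are controlled by unbiasedness and by the
    variance bound. *)
Lemma sgd_step_conditional (a : R) (y : 'rV[R]_d) :
  (\int[mu]_s (gap (y - a *: g y s))%:E <=
    (gap y - a * sqgrad y + l * a ^+ 2 / 2 * (sqgrad y + sigma ^+ 2))%:E)%E.
Proof.
have [_ _ /(_ y) vg] := hg.
pose c := l * a ^+ 2 / 2.
have c0 : 0 <= c by apply: divr_ge0 => //; rewrite mulr_ge0 ?sqr_ge0 ?ltW.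
pose W s := enorm (g y s - grad f y) ^+ 2.
pose I s := inner (grad f y) (g y s).
pose bd s := gap y - c * sqgrad y + (l * a ^+ 2 - a) * I s + c * W s.
have bdP s : gap (y - a *: g y s) <= bd s.
  have := smooth_descent y (- (a *: g y s)) l0 sf.
  rewrite -scaleNr innerC innerZl innerC enorm_sqrZ scaleNr -/(I s).
  have -> : enorm (g y s) ^+ 2 = W s + 2 * I s - sqgrad y.
    rewrite /W /I /sqgrad !enorm_sqr innerBl ![inner _ (_ - _)]innerC !innerBl.
    by rewrite (innerC (g y s) (grad f y)); ring.
  rewrite /gap /bd /gap /c => h; rewrite lerBlDr (le_trans h)//.
  by rewrite le_eqVlt; apply/orP; left; apply/eqP; field.
have iI := integrable_inner_oracle (grad f y) y.
have iW := integrable_oracle_variance y.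
have iK : mu.-integrable setT (fun=> (gap y - c * sqgrad y)%:E).
  exact: finite_measure_integrable_cst.
have ibd1 : mu.-integrable setT
   (fun s => ((gap y - c * sqgrad y)%:E + (l * a ^+ 2 - a)%:E * (I s)%:E)%E).
  by apply: integrableD => //; exact: integrableZl.
have ibd2 : mu.-integrable setT (fun s => (c%:E * (W s)%:E)%E) by exact: integrableZl.
have bdE : (\int[mu]_s (bd s)%:E = (gap y - c * sqgrad y)%:E +
    (l * a ^+ 2 - a)%:E * (sqgrad y)%:E + c%:E * \int[mu]_s (W s)%:E)%E.
  transitivity (\int[mu]_s (((gap y - c * sqgrad y)%:E + (l * a ^+ 2 - a)%:E * (I s)%:E)
     + c%:E * (W s)%:E))%E; first by [].
  rewrite integralD// integralD//; last exact: integrableZl.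
  rewrite !integralZl// integral_cst//.
  rewrite [X in (_ * X + _ + _)%E](_ : _ = 1%E) ?mule1; last exact: probability_setT.
  by rewrite integral_inner_oracle -enorm_sqr.
apply: (@le_trans _ _ (\int[mu]_s (bd s)%:E)%E).
  apply: ge0_le_integral => //.
  - by move=> s _; rewrite lee_fin gap_ge0.
  - apply/measurable_EFinP; apply: (measurableT_comp measurable_gap).
    have mp : measurable_fun setT (fun s : S => (y : borel_rV R d, s)).
      exact: measurable_fun_pair.
    exact: (measurableT_comp (measurable_sgd_step a) mp).
  - have ib : mu.-integrable setT (fun s => (bd s)%:E).
      exact: (integrableD measurableT ibd1 ibd2).
    by case/integrableP: ib.
  - by move=> s _; rewrite lee_fin.
rewrite bdE; have vgW : (c%:E * \int[mu]_s (W s)%:E <= c%:E * (sigma ^+ 2)%:E)%E.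
  by apply: lee_wpmul2l; [rewrite lee_fin|move: vg; rewrite unlock].
apply: (le_trans (leeD2l _ vgW)).
rewrite -!EFinM -!EFinD lee_fin le_eqVlt; apply/orP; left; apply/eqP.
by rewrite /c; field.
Qed.

Lemma sqgrad_le_gap y : sqgrad y <= 2 * l * gap y.
Proof. exact: smooth_sqr_grad_le. Qed.

Lemma measurable_gap_sgd t : measurable_fun setT (fun w => gap (x t w)).
Proof. exact: (measurableT_comp measurable_gap (measurable_sgd t)). Qed.

Lemma measurable_sqgrad_sgd t : measurable_fun setT (fun w => sqgrad (x t w)).
Proof.
exact: (measurableT_comp (measurable_sqr_grad l0 sf) (measurable_sgd t)).
Qed.

(** Domination by the gap: |grad f|^2 <= 2 l (f - min f). *)
Lemma integrable_sqgrad_sgd t :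
  P.-integrable setT (fun w => (gap (x t w))%:E) ->
  P.-integrable setT (fun w => (sqgrad (x t w))%:E).
Proof.
move=> ig; apply: (@le_integrable _ _ _ _ _ _ _
    (fun w => (2 * l)%:E * (gap (x t w))%:E)%E) => //.
- by apply/measurable_EFinP; exact: measurable_sqgrad_sgd.
- move=> w _; rewrite -EFinM lee_fin !ger0_norm ?sqgrad_le_gap ?sqr_ge0//.
  by rewrite !mulr_ge0 ?gap_ge0// ltW.
- exact: integrableZl.
Qed.

(** The conditional bound is integrated over the law of x_t. The left side is kept extended-real
    because integrability of the gap at t+1 is deduced from this inequality. *)
Lemma integral_gap_sgdS t :
  P.-integrable setT (fun w => (gap (x t w))%:E) ->
  (\int[P]_w (gap (x t.+1 w))%:E <= \int[P]_w (gap (x t w))%:E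
     + (l * step t ^+ 2 / 2 - step t)%:E * \int[P]_w (sqgrad (x t w))%:E
     + (l * step t ^+ 2 / 2 * sigma ^+ 2)%:E)%E.
Proof.
move=> ig; have is_ := integrable_sqgrad_sgd ig.
set a := step t; set c := l * a ^+ 2 / 2.
pose phi (z : borel_rV R d * S) := (gap ((z.1 : 'rV[R]_d) - a *: g z.1 z.2))%:E.
have mphi : measurable_fun setT phi.
  by apply/measurable_EFinP; exact: (measurableT_comp measurable_gap (measurable_sgd_step a)).
have phi0 z : (0 <= phi z)%E by rewrite lee_fin gap_ge0.
rewrite (expectation_fresh_sample hxi (measurable_sgd t) (@indep_sgd t) mphi phi0).
have iK : P.-integrable setT (fun=> (c * sigma ^+ 2)%:E).
  exact: finite_measure_integrable_cst.
have iS : P.-integrable setT (fun w => (c - a)%:E * (sqgrad (x t w))%:E)%E.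
  exact: integrableZl.
have iGS : P.-integrable setT
    (fun w => (gap (x t w))%:E + (c - a)%:E * (sqgrad (x t w))%:E)%E.
  exact: integrableD.
have iB : P.-integrable setT
    (fun w => (gap (x t w))%:E + (c - a)%:E * (sqgrad (x t w))%:E
       + (c * sigma ^+ 2)%:E)%E.
  exact: integrableD.
apply: (@le_trans _ _ (\int[P]_w ((gap (x t w))%:E
    + (c - a)%:E * (sqgrad (x t w))%:E + (c * sigma ^+ 2)%:E))%E).
  apply: ge0_le_integral => //.
  - by move=> w _; apply: integral_ge0.
  - have mF := measurable_fun_fubini_tonelli_F (m2 := mu) phi mphi phi0.
    exact: (measurableT_comp mF (measurable_sgd t)).
  - by case/integrableP: iB.
  - move=> w _; apply: le_trans (sgd_step_conditional a (x t w)) _.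
    rewrite -EFinM -!EFinD lee_fin le_eqVlt; apply/orP; left; apply/eqP.
    by rewrite /c; ring.
rewrite integralD// integralD// integralZl// integral_cst//.
by rewrite [X in (_ + _ * X)%E](_ : _ = 1%E) ?mule1//; exact: probability_setT.
Qed.

Lemma integrable_gap_sgd t : P.-integrable setT (fun w => (gap (x t w))%:E).
Proof.
elim: t => [|t IH].
  change (P.-integrable setT (fun=> (gap x0)%:E)).
  exact: finite_measure_integrable_cst.
apply/integrableP; split; first exact/measurable_EFinP/measurable_gap_sgd.
under eq_integral do rewrite gee0_abs ?lee_fin ?gap_ge0//.
apply: le_lt_trans (integral_gap_sgdS IH) _.
have fg := integrable_fin_num measurableT IH.
have fs := integrable_fin_num measurableT (integrable_sqgrad_sgd IH).
by rewrite -(fineK fg) -(fineK fs) -EFinM -!EFinD ltry.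
Qed.

(** Real-valued expectations; [expected_gapE] and [expected_sqgradE] show that the integrals are
    finite, so [fine] never returns its default value. *)
Definition expected_gap t : R := fine (\int[P]_w (gap (x t w))%:E).
Definition expected_sqgrad t : R := fine (\int[P]_w (sqgrad (x t w))%:E).

Lemma expected_gapE t : (\int[P]_w (gap (x t w))%:E = (expected_gap t)%:E)%E.
Proof. by rewrite fineK//; apply: integrable_fin_num => //; exact: integrable_gap_sgd. Qed.

Lemma expected_sqgradE t : (\int[P]_w (sqgrad (x t w))%:E = (expected_sqgrad t)%:E)%E.
Proof.
rewrite fineK//; apply: integrable_fin_num => //.
exact/integrable_sqgrad_sgd/integrable_gap_sgd.
Qed.

Lemma expected_gap0 : expected_gap 0 = f x0 - f xmin.
Proof.
change (fine (\int[P]_w (cst (gap x0)%:E w)) = gap x0).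
by rewrite integral_cst// [X in (_ * X)%E](_ : _ = 1%E) ?mule1//; exact: probability_setT.
Qed.

Lemma expected_gap_ge0 t : 0 <= expected_gap t.
Proof. by apply: fine_ge0; apply: integral_ge0 => w _; rewrite lee_fin gap_ge0. Qed.

Lemma expected_sqgrad_ge0 t : 0 <= expected_sqgrad t.
Proof. by apply: fine_ge0; apply: integral_ge0 => w _; rewrite lee_fin sqr_ge0. Qed.

Lemma expected_sqgrad_le_gap t : expected_sqgrad t <= 2 * l * expected_gap t.
Proof.
rewrite -lee_fin EFinM -expected_gapE -expected_sqgradE.
rewrite -integralZl//; last exact: integrable_gap_sgd.
apply: ge0_le_integral => //.
- by move=> w _; rewrite lee_fin sqr_ge0.
- exact/measurable_EFinP/measurable_sqgrad_sgd.
- by apply: measurable_funeM; exact/measurable_EFinP/measurable_gap_sgd.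
- by move=> w _; rewrite -EFinM lee_fin sqgrad_le_gap.
Qed.

Lemma expected_gapS t : expected_gap t.+1 <= expected_gap t
  + (l * step t ^+ 2 / 2 - step t) * expected_sqgrad t
  + l * step t ^+ 2 / 2 * sigma ^+ 2.
Proof.
rewrite -lee_fin !EFinD EFinM -!expected_gapE -expected_sqgradE.
exact/integral_gap_sgdS/integrable_gap_sgd.
Qed.

Lemma mean_sq_gradE T : mean_sq_grad P f x T
  = (T%:R^-1 * \sum_(0 <= t < T) expected_sqgrad t)%:E.
Proof.
rewrite /mean_sq_grad unlock.
transitivity (\int[P]_w (T%:R^-1%:E * \sum_(t < T) (sqgrad (x t w))%:E))%E.
  by apply: eq_integral => w _; rewrite EFinM big_mkord sumEFin.
rewrite ge0_integralZl//; last 2 first.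
- apply: emeasurable_sum => t.
  exact/measurable_EFinP/measurable_sqgrad_sgd.
- by move=> w _; apply: sume_ge0 => t _; rewrite lee_fin sqr_ge0.
rewrite EFinM; congr (_ * _)%E.
rewrite ge0_integral_sum//; last 2 first.
- by move=> t; exact/measurable_EFinP/measurable_sqgrad_sgd.
- by move=> t w _; rewrite lee_fin sqr_ge0.
by rewrite big_mkord -sumEFin; apply: eq_bigr => t _; rewrite expected_sqgradE.
Qed.

End sgd_recursion.

(** * Solving the recursion *)

Section descent_recursion.
Context (R : realType) (l sg2 : R) (step D G : nat -> R).
Hypotheses (l0 : 0 < l) (sg0 : 0 <= sg2) (step0 : forall t, 0 <= step t)
  (D0 : forall t, 0 <= D t) (G0 : forall t, 0 <= G t)
  (GD : forall t, G t <= 2 * l * D t)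
  (DS : forall t, D t.+1 <= D t + (l * step t ^+ 2 / 2 - step t) * G t
                    + l * step t ^+ 2 / 2 * sg2).

(** [v] is the noise injected by one step and [V] its accumulation; [C] bounds the amplification of
    the gap over n large steps. *)
Let v t := l * step t ^+ 2 / 2 * sg2.
Let C n := \prod_(0 <= t < n) (l * step t) ^+ 2.
Let V n := \sum_(0 <= t < n) v t.

Lemma noise_ge0 t : 0 <= v t.
Proof. by rewrite /v mulr_ge0// divr_ge0// mulr_ge0 ?sqr_ge0// ltW. Qed.

Lemma noise_sum_monotone m n : (m <= n)%N -> V m <= V n.
Proof.
move=> mn; rewrite /V (@big_cat_nat _ _ _ m 0 n)//= lerDl.
by apply: sumr_ge0 => t _; exact: noise_ge0.
Qed.

Lemma noise_sum_ge0 n : 0 <= V n.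
Proof. by apply: sumr_ge0 => t _; exact: noise_ge0. Qed.

(** Telescoping from an arbitrary start s: s = 0 serves when all steps are small, s = n serves the
    tail after n large steps. *)
Lemma small_step_sum s n : (s <= n)%N ->
  (forall t, (s <= t)%N -> l * step t <= 1) ->
  D n + \sum_(s <= t < n) step t / 2 * G t <= D s + \sum_(s <= t < n) v t.
Proof.
move=> sn small; rewrite -(subnKC sn); elim: (n - s)%N => [|k IH].
  by rewrite addn0 !big_geq.
rewrite addnS !big_nat_recr ?leq_addr//=.
set t := (s + k)%N in IH *.
have lt1 : l * step t <= 1 by apply: small; rewrite leq_addr.
have h := DS t; have := G0 t; have := step0 t; rewrite -/(v t) in h.
move=> a0 g0.
have : (l * step t ^+ 2 / 2 - step t) * G t <= - (step t / 2 * G t).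
  have -> : l * step t ^+ 2 / 2 - step t = - (step t / 2) - step t / 2 * (1 - l * step t).
    by field.
  rewrite mulrBl mulNr gerBl mulr_ge0// mulr_ge0 ?subr_ge0//.
  by rewrite divr_ge0.
by lra.
Qed.

Lemma large_step_prod_ge1 n : (forall t, (t < n)%N -> 1 <= l * step t) -> 1 <= C n.
Proof.
elim: n => [|n IH] large; first by rewrite /C big_nil.
rewrite /C big_nat_recr//= -[leLHS]mulr1 ler_pM//.
  by apply: IH => t tn; apply: large; exact: ltnW.
by rewrite -(expr1n _ 2) lerXn2r ?nnegrE ?mulr_ge0 ?(ltW l0)// large.
Qed.

Lemma large_step_prod_monotone m n : (m <= n)%N ->
  (forall t, (t < n)%N -> 1 <= l * step t) -> C m <= C n.
Proof.
elim: n => [|n IH]; first by rewrite leqn0 => /eqP ->.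
rewrite leq_eqVlt => /orP[/eqP -> //|mn] large.
have large' t : (t < n)%N -> 1 <= l * step t by move=> tn; apply: large; exact: ltnW.
apply: (le_trans (IH mn large')); rewrite {2}/C big_nat_recr//= -/(C n).
have C1 := large_step_prod_ge1 large'.
rewrite ler_peMr ?(le_trans _ C1)//.
by rewrite -(expr1n _ 2) lerXn2r ?nnegrE ?mulr_ge0 ?(ltW l0)// large.
Qed.

(* When l * step t >= 1 the gradient term can have the wrong sign; bounding it
   by G <= 2 l D multiplies the gap by at most (1 - l * step t)^2. *)
Lemma large_step_growth n : (forall t, (t < n)%N -> 1 <= l * step t) ->
  D n <= C n * (D 0 + V n).
Proof.
elim: n => [|n IH] large.
  by rewrite /C /V !big_nil mul1r addr0.
have large' t : (t < n)%N -> 1 <= l * step t by move=> tn; apply: large; exact: ltnW.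
have q1 : 1 <= l * step n by exact: large.
have h := DS n; rewrite -/(v n) in h.
have {}h : D n.+1 <= (l * step n) ^+ 2 * D n + v n.
  apply: (le_trans h); rewrite lerD2r.
  have e : l * step n ^+ 2 / 2 - step n = step n * (l * step n / 2 - 1) by field.
  have d0 := D0 n; have g0 := G0 n; have gd := GD n; have a0 := step0 n.
  (* While l s <= 2 the gradient term is nonpositive and is dropped; only beyond 2 is G <= 2 l D
     needed. *)
  have [neg|pos] := leP (l * step n / 2 - 1) 0.
    have : (l * step n ^+ 2 / 2 - step n) * G n <= 0.
      by rewrite e mulr_le0_ge0// mulr_ge0_le0.
    have : D n <= (l * step n) ^+ 2 * D n.
      by rewrite ler_peMl// -(expr1n _ 2) lerXn2r ?nnegrE// (le_trans _ q1).
    by lra.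
  have : (l * step n ^+ 2 / 2 - step n) * G n
      <= (l * step n ^+ 2 / 2 - step n) * (2 * l * D n).
    by rewrite ler_wpM2l// e mulr_ge0// ltW.
  have -> : (l * step n ^+ 2 / 2 - step n) * (2 * l * D n)
    = (l * step n) ^+ 2 * D n - 2 * (l * step n * D n) by field.
  have : D n <= l * step n * D n by rewrite ler_peMl.
  by lra.
apply: (le_trans h).
have C1 := large_step_prod_ge1 large.
(* The newest noise term may be multiplied by the whole product, which is at least 1. *)
rewrite /V big_nat_recr//= addrA mulrDr; apply: lerD; last first.
  by rewrite ler_peMl ?noise_ge0.
rewrite /C big_nat_recr//= -/(C n) -/(V n) [leRHS]mulrAC [leRHS]mulrC.
by rewrite ler_wpM2l ?sqr_ge0// IH.
Qed.

(** The sum is split at n. Before n, (s_t/2) G_t <= l s_t D_t with D_t controlled by the growth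
    bound, giving the part with the factor l times the sum of steps. From n on, telescoping starts
    at D_n and gives the summand 1. *)
Lemma large_step_sum n T : (forall t, (t < n)%N -> 1 <= l * step t) ->
  (forall t, (n <= t)%N -> l * step t <= 1) ->
  \sum_(0 <= t < T) step t / 2 * G t
    <= C n * (1 + l * \sum_(0 <= t < n) step t) * (D 0 + V T).
Proof.
move=> large small.
have C1 := large_step_prod_ge1 large.
have Cn0 : 0 <= C n by exact: le_trans C1.
have first_sum m : (m <= n)%N -> (m <= T)%N ->
    \sum_(0 <= t < m) step t / 2 * G t
      <= l * (\sum_(0 <= t < m) step t) * (C n * (D 0 + V T)).
  move=> mn mT; rewrite mulrAC mulr_sumr.
  rewrite big_nat_cond [leRHS]big_nat_cond; apply: ler_sum => t.
  rewrite andbT => /andP[_ tm].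
  have tn : (t < n)%N by exact: leq_trans mn.
  have tlarge s : (s < t)%N -> 1 <= l * step s.
    by move=> st; apply: large; exact: ltn_trans tn.
  have Dt : D t <= C n * (D 0 + V T).
    apply: (le_trans (large_step_growth tlarge)); apply: ler_pM.
    - exact: le_trans (large_step_prod_ge1 tlarge).
    - by rewrite addr_ge0 ?noise_sum_ge0.
    - by apply: large_step_prod_monotone => //; exact: ltnW.
    - by rewrite lerD2l noise_sum_monotone// (leq_trans (ltnW tm)).
  apply: (@le_trans _ _ (step t / 2 * (2 * l * D t))).
    by rewrite ler_wpM2l// divr_ge0.
  have -> : step t / 2 * (2 * l * D t) = l * (step t * D t) by field.
  by rewrite -mulrA [_ * step t]mulrC ler_wpM2l ?(ltW l0)// ler_wpM2l.
have DV0 : 0 <= D 0 + V T by rewrite addr_ge0 ?noise_sum_ge0.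
have CDV0 : 0 <= C n * (D 0 + V T) by rewrite mulr_ge0.
have -> : C n * (1 + l * \sum_(0 <= t < n) step t) * (D 0 + V T)
  = C n * (D 0 + V T) + l * (\sum_(0 <= t < n) step t) * (C n * (D 0 + V T)) by ring.
have [Tn|nT] := leqP T n.
  apply: (le_trans (first_sum T Tn (leqnn T))).
  apply: (@le_trans _ _ (l * (\sum_(0 <= t < n) step t) * (C n * (D 0 + V T)))).
    rewrite ler_wpM2r// ler_wpM2l ?(ltW l0)//.
    by rewrite (@big_cat_nat _ _ _ T 0 n)//= lerDl sumr_ge0.
  by rewrite lerDr.
rewrite (@big_cat_nat _ _ _ n 0 T)//=; last exact: ltnW.
rewrite addrC; apply: lerD; last by apply: first_sum => //; exact: ltnW.
have h := small_step_sum (ltnW nT) small.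
have := large_step_growth large.
have -> : V T = V n + \sum_(n <= t < T) v t.
  by rewrite /V (@big_cat_nat _ _ _ n 0 T)//= ltnW.
(* Since C n >= 1, the tail noise can be put under the same factor: D_n plus the tail noise is at
   most C_n (D_0 + V_T). *)
have W0 : 0 <= \sum_(n <= t < T) v t by apply: sumr_ge0 => t _; exact: noise_ge0.
have : \sum_(n <= t < T) v t <= C n * (\sum_(n <= t < T) v t) by rewrite ler_peMl.
have := D0 T.
move: h W0; set W := \sum_(_ <= _ < _) v _; set Z := \sum_(_ <= _ < _) _.
by move: (C n) => c; rewrite !mulrDr; lra.
Qed.

End descent_recursion.

(** * Estimates for the steps eta/(t+1)^alpha *)

Section polynomial_steps.
Context (R : realType) (l eta alpha : R).
Hypotheses (l0 : 0 < l) (eta0 : 0 < eta) (alpha0 : 0 < alpha) (alpha1 : alpha < 1).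

Let step := poly_step eta alpha.

Lemma poly_step_gt0 t : 0 < step t.
Proof. by rewrite divr_gt0// powR_gt0. Qed.

Lemma sqr_poly_step t : step t ^+ 2 = eta ^+ 2 * t.+1%:R `^ (- (2 * alpha)).
Proof.
rewrite /step /poly_step exprMn exprVn; congr (_ * _).
by rewrite powRN -powR_mulrn ?powR_ge0// -powRrM mulrC.
Qed.

(** Each of the T steps is at least eta/T^alpha, so the weighted gradient sum controls the plain
    average. [K] stands for the cost of the large steps and [H] for any bound on the power sum, left
    open for the three ranges of alpha. *)
Lemma poly_step_rate (sg2 Delta K H D0 : R) (G : nat -> R) (T : nat) :
  0 <= sg2 -> (0 < T)%N -> (forall t, 0 <= G t) -> 0 <= K -> D0 <= Delta ->
  \sum_(0 <= t < T) step t / 2 * G t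
    <= K * (D0 + \sum_(0 <= t < T) l * step t ^+ 2 / 2 * sg2) ->
  \sum_(0 <= t < T) t.+1%:R `^ (- (2 * alpha)) <= H ->
  T%:R^-1 * \sum_(0 <= t < T) G t
    <= 2 / (eta * T%:R `^ (1 - alpha)) * K * (Delta + l * sg2 * eta ^+ 2 / 2 * H).
Proof.
move=> sg0 T0 G0 K0 D0Delta hsum hH.
have T0' : 0 < T%:R :> R by rewrite ltr0n.
have noise : \sum_(0 <= t < T) l * step t ^+ 2 / 2 * sg2 <= l * sg2 * eta ^+ 2 / 2 * H.
  apply: (@le_trans _ _ (l * sg2 * eta ^+ 2 / 2 *
      \sum_(0 <= t < T) t.+1%:R `^ (- (2 * alpha)))).
    rewrite mulr_sumr; apply: ler_sum => t _; rewrite sqr_poly_step.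
    by rewrite le_eqVlt; apply/orP; left; apply/eqP; field.
  by rewrite ler_wpM2l// divr_ge0// !mulr_ge0 ?(ltW l0) ?(ltW eta0).
have lower : eta / T%:R `^ alpha / 2 * \sum_(0 <= t < T) G t
    <= \sum_(0 <= t < T) step t / 2 * G t.
  rewrite mulr_sumr big_nat_cond [leRHS]big_nat_cond; apply: ler_sum => t.
  rewrite andbT => /andP[_ tT]; rewrite ler_wpM2r// ler_wpM2r// /step /poly_step.
  rewrite ler_wpM2l ?(ltW eta0)// lef_pV2 ?posrE ?powR_gt0//.
  by rewrite ge0_ler_powR ?nnegrE ?(ltW alpha0)// ler_nat.
have -> : T%:R^-1 * \sum_(0 <= t < T) G t = 2 / (eta * T%:R `^ (1 - alpha))
    * (eta / T%:R `^ alpha / 2 * \sum_(0 <= t < T) G t).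
  rewrite powRB; last by rewrite gt_eqF ?implybT.
  rewrite powRr1 ?ltW//; field.
  by rewrite !gt_eqF ?powR_gt0.
rewrite -[leRHS]mulrA ler_wpM2l//.
  by rewrite divr_ge0// mulr_ge0 ?(ltW eta0)// powR_ge0.
apply: (le_trans lower); apply: (le_trans hsum); rewrite ler_wpM2l//.
by rewrite lerD.
Qed.

(** The summand 1 is slack, giving the factor the shape required in the final bound. *)
Lemma sum_poly_step_le n :
  \sum_(0 <= t < n) step t <= eta * (1 + n%:R `^ (1 - alpha) / (1 - alpha)).
Proof.
have -> : \sum_(0 <= t < n) step t = eta * \sum_(0 <= t < n) t.+1%:R `^ (- alpha).
  by rewrite mulr_sumr; apply: eq_bigr => t _; rewrite powRN.
rewrite ler_wpM2l ?(ltW eta0)//.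
by apply: (le_trans (sum_powRN_lt1_le n alpha0 alpha1)); rewrite lerDr.
Qed.

(** From eta l <= (n+1)^alpha, each factor is at most the alpha-th power of ((n+1)/(t+1))^2; the
    weak Stirling bound is then raised to the power alpha. *)
Lemma prod_poly_step_le n : (0 < n)%N -> eta * l <= n.+1%:R `^ alpha ->
  \prod_(0 <= t < n) (l * step t) ^+ 2
    <= (4 * expR (2 * alpha)) ^+ n / (2 * pi * n%:R) `^ alpha.
Proof.
move=> n0 etal; have pn0 : 0 < 2 * pi * n%:R :> R.
  by rewrite !mulr_gt0 ?pi_gt0 ?ltr0n.
pose X : R := \prod_(0 <= t < n) (n.+1%:R / t.+1%:R) ^+ 2.
have X0 : 0 <= X by apply: prodr_ge0 => t _; exact: sqr_ge0.
have prodX : \prod_(0 <= t < n) (l * step t) ^+ 2 <= X `^ alpha.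
  have -> : X `^ alpha = \prod_(0 <= t < n) ((n.+1%:R / t.+1%:R) ^+ 2) `^ alpha.
    by rewrite -powR_prod// => t; exact: sqr_ge0.
  apply: ler_prod => t _; rewrite sqr_ge0/=.
  have -> : ((n.+1%:R / t.+1%:R) ^+ 2) `^ alpha
      = (n.+1%:R `^ alpha / t.+1%:R `^ alpha) ^+ 2 :> R.
    rewrite -!powR_mulrn ?divr_ge0 ?powR_ge0// powRAC; congr (_ `^ _).
    by rewrite powRM ?invr_ge0// -powR_inv1// powRAC powR_inv1 ?powR_ge0.
  rewrite lerXn2r ?nnegrE ?divr_ge0 ?powR_ge0//.
    by rewrite mulr_ge0 ?(ltW l0)// ltW// poly_step_gt0.
  by rewrite /step /poly_step mulrA [l * _]mulrC ler_wpM2r// invr_ge0 powR_ge0.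
apply: (le_trans prodX); rewrite ler_pdivlMr ?powR_gt0//.
rewrite -powRM ?(ltW pn0)//.
apply: (@le_trans _ _ (((4 * expR 1 ^+ 2) ^+ n) `^ alpha)).
  have A0 : 0 <= X * (2 * pi * n%:R) by rewrite mulr_ge0 ?(ltW pn0).
  have B0 : 0 <= (4 * expR 1 ^+ 2) ^+ n :> R.
    by rewrite exprn_ge0// mulr_ge0 ?sqr_ge0.
  apply: ge0_ler_powR; rewrite ?nnegrE ?(ltW alpha0)//.
  by rewrite mulrC; exact: prod_ratio_le.
rewrite -powR_mulrn ?mulr_ge0 ?sqr_ge0// powRAC powR_mulrn ?powR_ge0//.
apply: lerXn2r; rewrite ?nnegrE ?powR_ge0 ?mulr_ge0 ?expR_ge0//.
(* 4^alpha is relaxed to 4, while (e^2)^alpha is exactly e^(2 alpha). *)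
rewrite powRM ?sqr_ge0//; apply: ler_pM; rewrite ?powR_ge0//.
  by apply: ler1_powR; [rewrite ler1n|exact: ltW].
by rewrite expRM -expRM_natl mulr1.
Qed.

End polynomial_steps.

(** The power sum has exponent 2 alpha, so comparing alpha with 1/2 decides between logarithmic
    growth, boundedness and growth like T^(1 - 2 alpha). *)
Lemma three_regimes (R : realType) (l sigma Delta eta alpha m : R) (T : nat) (K : R) :
  0 < l -> 0 < eta -> 0 < alpha -> alpha < 1 -> (0 < T)%N ->
  (forall H, \sum_(0 <= t < T) t.+1%:R `^ (- (2 * alpha)) <= H ->
    m <= 2 / (eta * T%:R `^ (1 - alpha)) * K
         * (Delta + l * sigma ^+ 2 * eta ^+ 2 / 2 * H)) ->
  [/\ alpha = 1 / 2 -> m <= 2 / (eta * Num.sqrt T%:R) * K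
        * (Delta + l * sigma ^+ 2 * eta ^+ 2 / 2 * (1 + ln T%:R)),
      1 / 2 < alpha -> m <= 2 / (eta * T%:R `^ (1 - alpha)) * K
        * (Delta + l * sigma ^+ 2 * eta ^+ 2 / (2 * (1 - 2 `^ (1 - 2 * alpha))))
    & alpha < 1 / 2 -> m <= 2 / (eta * T%:R `^ alpha) * K
        * (Delta / T%:R `^ (1 - 2 * alpha)
           + l * sigma ^+ 2 * eta ^+ 2 / (2 * (1 - 2 * alpha)))].
Proof.
move=> l0 eta0 alpha0 alpha1 T0 rate; have T0' : 0 < T%:R :> R by rewrite ltr0n.
split=> halpha.
- have -> : Num.sqrt T%:R = T%:R `^ (1 - alpha) :> R.
    by rewrite -powR12_sqrt ?(ltW T0')//; congr (_ `^ _); rewrite halpha; field.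
  apply: rate; rewrite (_ : 2 * alpha = 1); last by rewrite halpha; field.
  exact: sum_powRN1_le.
- have q1 : 1 < 2 * alpha by lra.
  rewrite [_ / (2 * _)](_ : _ = l * sigma ^+ 2 * eta ^+ 2 / 2
      * (1 - 2 `^ (1 - 2 * alpha))^-1); last by rewrite invfM mulrA.
  exact/rate/sum_powRN_le.
- have q0 : 0 < 2 * alpha by lra.
  have q1 : 2 * alpha < 1 by lra.
  have -> : 2 / (eta * T%:R `^ alpha) * K * (Delta / T%:R `^ (1 - 2 * alpha)
      + l * sigma ^+ 2 * eta ^+ 2 / (2 * (1 - 2 * alpha)))
    = 2 / (eta * T%:R `^ (1 - alpha)) * K * (Delta + l * sigma ^+ 2 * eta ^+ 2 / 2
        * (T%:R `^ (1 - 2 * alpha) / (1 - 2 * alpha))).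
    (* The growing factor T^(1 - 2 alpha) is taken out of the bracket, which turns the rate T^(1 -
       alpha) into T^alpha and divides Delta. *)
    have -> : T%:R `^ (1 - alpha) = T%:R `^ alpha * T%:R `^ (1 - 2 * alpha) :> R.
      by rewrite -powRD ?(gt_eqF T0') ?implybT//; congr (_ `^ _); ring.
    have a0 : T%:R `^ alpha != 0 :> R by rewrite gt_eqF ?powR_gt0.
    have b0 : T%:R `^ (1 - 2 * alpha) != 0 :> R by rewrite gt_eqF ?powR_gt0.
    have c0 : 1 - 2 * alpha != 0 by rewrite gt_eqF// subr_gt0.
    by field; rewrite a0 b0 c0 gt_eqF.
  exact/rate/sum_powRN_lt1_le.
Qed.

(** * The six rates, for eta below and above 1/l *)

Theorem theorem6 (R : realType) (d : nat)
    (dS : measure_display) (S : measurableType dS) (mu : probability S R)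
    (dO : measure_display) (Omega : measurableType dO) (P : probability Omega R)
    (f : 'rV[R]_d -> R) (l sigma Delta eta alpha : R)
    (g : 'rV[R]_d -> S -> 'rV[R]_d) (xi : nat -> {RV P >-> S})
    (x0 xmin : 'rV[R]_d) (T : nat)
    (hl : 0 < l) (hf : smooth l f)
    (hg : stochastic_gradient mu f sigma g)
    (hxi : iid_samples mu xi)
    (hmin : forall x, f xmin <= f x) (hDelta : f x0 - f xmin <= Delta)
    (heta : 0 < eta) (halpha0 : 0 < alpha) (halpha1 : alpha < 1)
    (hT : (1 <= T)%N) :
  let x := sgd g (poly_step eta alpha) x0 xi in
  let tau : int := Num.ceil ((eta * l) `^ (1 / alpha) - 1) in
  (eta <= 1 / l ->
    [/\ alpha = 1 / 2 ->
          (mean_sq_grad P f x T <=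
            (2 / (eta * Num.sqrt T%:R)
             * (Delta + l * sigma ^+ 2 * eta ^+ 2 / 2 * (1 + ln T%:R)))%:E)%E,
        1 / 2 < alpha ->
          (mean_sq_grad P f x T <=
            (2 / (eta * T%:R `^ (1 - alpha))
             * (Delta + l * sigma ^+ 2 * eta ^+ 2
                        / (2 * (1 - 2 `^ (1 - 2 * alpha)))))%:E)%E
      & alpha < 1 / 2 ->
          (mean_sq_grad P f x T <=
            (2 / (eta * T%:R `^ alpha)
             * (Delta / T%:R `^ (1 - 2 * alpha)
                + l * sigma ^+ 2 * eta ^+ 2 / (2 * (1 - 2 * alpha))))%:E)%E])
  /\
  (1 / l < eta ->
    [/\ alpha = 1 / 2 ->
          (mean_sq_grad P f x T <=
            (Num.sqrt 2 * (4 * expR 1) ^ tau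
             / (eta * Num.sqrt (pi * tau%:~R * T%:R))
             * (1 + l * eta * (1 + 2 * Num.sqrt tau%:~R))
             * (Delta + l * sigma ^+ 2 * eta ^+ 2 / 2 * (1 + ln T%:R)))%:E)%E,
        1 / 2 < alpha ->
          (mean_sq_grad P f x T <=
            (2 * (4 * expR (2 * alpha)) ^ tau
             / (eta * (2 * pi * tau%:~R) `^ alpha * T%:R `^ (1 - alpha))
             * (1 + l * eta * (1 + tau%:~R `^ (1 - alpha) / (1 - alpha)))
             * (Delta + l * sigma ^+ 2 * eta ^+ 2
                        / (2 * (1 - 2 `^ (1 - 2 * alpha)))))%:E)%E
      & alpha < 1 / 2 ->
          (mean_sq_grad P f x T <=
            (2 * (4 * expR (2 * alpha)) ^ tau
             / (eta * (2 * pi * tau%:~R) `^ alpha * T%:R `^ alpha)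
             * (1 + l * eta * (1 + tau%:~R `^ (1 - alpha) / (1 - alpha)))
             * (Delta / T%:R `^ (1 - 2 * alpha)
                + l * sigma ^+ 2 * eta ^+ 2 / (2 * (1 - 2 * alpha))))%:E)%E]).
Proof.
move=> x tau; set step := poly_step eta alpha in x *.
pose D := expected_gap f g xi x0 xmin step.
pose G := expected_sqgrad f g xi x0 step.
have sg0 : 0 <= sigma ^+ 2 by exact: sqr_ge0.
have step0 t : 0 <= step t by rewrite ltW// poly_step_gt0.
have D0 t : 0 <= D t by exact: expected_gap_ge0.
have G0 t : 0 <= G t by exact: expected_sqgrad_ge0.
have GD t : G t <= 2 * l * D t by exact: (expected_sqgrad_le_gap _ _ hl hf hg hxi hmin).
have DS t : D t.+1 <= D t + (l * step t ^+ 2 / 2 - step t) * G t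
    + l * step t ^+ 2 / 2 * sigma ^+ 2.
  exact: (expected_gapS _ _ hl hf hg hxi hmin).
have DD : D 0%N <= Delta by rewrite /D expected_gap0.
rewrite (mean_sq_gradE _ _ hl hf hg hxi hmin) -/G !lee_fin.
(* Each range of eta now only has to supply a constant [K] for the weighted gradient sum. *)
have bound K : 0 <= K -> \sum_(0 <= t < T) step t / 2 * G t
    <= K * (D 0%N + \sum_(0 <= t < T) l * step t ^+ 2 / 2 * sigma ^+ 2) -> _ :=
  fun K0 hK => @three_regimes _ l sigma Delta eta alpha _ T K hl heta halpha0 halpha1 hT
  (fun H => @poly_step_rate _ l eta alpha hl heta halpha0 halpha1
     _ _ _ H _ _ _ sg0 hT G0 K0 DD hK).
have stepl t : l * step t = eta * l / t.+1%:R `^ alpha.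
  by rewrite /step /poly_step mulrA [l * _]mulrC.
split=> hetal.
  (* For eta <= 1/l every step is small: telescoping from 0 gives K = 1. *)
  have small t : (0 <= t)%N -> l * step t <= 1.
    move=> _; rewrite stepl ler_pdivrMr ?powR_gt0// mul1r.
    apply: (@le_trans _ _ 1); first by move: hetal; rewrite ler_pdivlMr.
    by rewrite -[leLHS](powRr0 t.+1%:R) ler_powR ?ler1n ?ltW.
  have := @bound 1 ler01; rewrite mul1r !mulr1; apply.
  have := small_step_sum step0 G0 DS (leq0n T) small.
  by apply: le_trans; rewrite lerDr.
have etal1 : 1 < eta * l by move: hetal; rewrite ltr_pdivrMr.
have etal0 : 0 <= eta * l by rewrite mulr_ge0 ?ltW.
(* l s_t = (u/(t+1))^alpha crosses 1 at t + 1 = u. As tau = ceil (u - 1), tau < u <= tau + 1, so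
   exactly the steps t < tau are treated as large. *)
pose u := (eta * l) `^ (1 / alpha).
have u1 : 1 < u.
  have <- : 1 `^ (1 / alpha) = 1 :> R by rewrite powR1.
  by rewrite gt0_ltr_powR ?nnegrE ?divr_gt0.
have uE : u `^ alpha = eta * l.
  by rewrite /u -powRrM divfK ?gt_eqF// powRr1.
have u0 : 0 <= u by rewrite ltW// (lt_trans _ u1).
(* Positivity of tau turns the integer power into a natural one and keeps the denominators
   nonzero. *)
have tau0 : 0 < tau by rewrite -(ltr_int R) (lt_le_trans _ (ceil_ge _))// subr_gt0.
have [n tauE] : exists n : nat, tau = n%:Z by exists `|tau|%N; rewrite gtz0_abs.
have n0 : (0 < n)%N by move: tau0; rewrite tauE.
have un : u <= n.+1%:R.
  have := ceil_ge (u - 1); rewrite -/tau tauE -pmulrn lerBlDr natr1; exact.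
have nu : n%:R < u.
  have := ceilB1_lt (u - 1); rewrite -/tau tauE intrB -pmulrn; lra.
rewrite tauE -pmulrn -!exprnP.
have large t : (t < n)%N -> 1 <= l * step t.
  move=> tn; rewrite stepl ler_pdivlMr ?powR_gt0// mul1r -uE.
  rewrite ge0_ler_powR ?nnegrE ?(ltW halpha0)//.
  by rewrite (le_trans _ (ltW nu))// ler_nat.
have small t : (n <= t)%N -> l * step t <= 1.
  move=> nt; rewrite stepl ler_pdivrMr ?powR_gt0// mul1r -uE.
  rewrite ge0_ler_powR ?nnegrE ?(ltW halpha0)//.
  by rewrite (le_trans un)// ler_nat ltnS.
have p0 : 0 < (2 * pi * n%:R) `^ alpha by apply: powR_gt0; rewrite !mulr_gt0 ?pi_gt0 ?ltr0n.
have w0 : 0 <= 1 + n%:R `^ (1 - alpha) / (1 - alpha).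
  by rewrite addr_ge0// divr_ge0 ?powR_ge0// subr_ge0 ltW.
pose K := (4 * expR (2 * alpha)) ^+ n / (2 * pi * n%:R) `^ alpha
  * (1 + l * eta * (1 + n%:R `^ (1 - alpha) / (1 - alpha))).
have K0 : 0 <= K.
  apply: mulr_ge0.
    by apply: divr_ge0; [rewrite exprn_ge0 ?mulr_ge0 ?expR_ge0|exact: ltW].
  by rewrite addr_ge0// !mulr_ge0// ltW.
have hK : \sum_(0 <= t < T) step t / 2 * G t
    <= K * (D 0%N + \sum_(0 <= t < T) l * step t ^+ 2 / 2 * sigma ^+ 2).
  apply: (le_trans (large_step_sum hl sg0 step0 D0 G0 GD DS T large small)).
  rewrite ler_wpM2r//.
    by rewrite addr_ge0// (noise_sum_ge0 _ hl sg0).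
  apply: ler_pM.
  - by apply: prodr_ge0 => t _; exact: sqr_ge0.
  - by rewrite addr_ge0// mulr_ge0 ?(ltW hl)// sumr_ge0.
  - apply: prod_poly_step_le => //.
    by rewrite -uE ge0_ler_powR ?nnegrE ?(ltW halpha0).
  - by rewrite lerD2l -mulrA ler_wpM2l ?(ltW hl)// sum_poly_step_le.
have [b1 b2 b3] := @bound K K0 hK.
split=> halpha.
- apply: (le_trans (b1 halpha)); rewrite ler_wpM2r//.
    apply: addr_ge0; first exact: le_trans (D0 0%N) DD.
    apply: mulr_ge0; last by rewrite addr_ge0 ?ln_ge0 ?ler1n.
    apply: divr_ge0 => //; apply: mulr_ge0; last exact: sqr_ge0.
    by apply: mulr_ge0; [exact: ltW|].
  (* At alpha = 1/2 both sides are equal: 1/(1 - alpha) = 2, and 2/sqrt (2 pi n) = sqrt 2/sqrt (pi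
     n) once 2 is written as the square of sqrt 2. *)
  rewrite le_eqVlt; apply/orP; left; apply/eqP.
  rewrite /K (_ : 1 - alpha = 2^-1); last by rewrite halpha; field.
  rewrite (_ : 2 * alpha = 1); last by rewrite halpha; field.
  rewrite (_ : alpha = 2^-1); last by rewrite halpha mul1r.
  have pi0 : 0 <= pi :> R := pi_ge0 R.
  rewrite !powR12_sqrt ?mulr_ge0//.
  rewrite -[2 * pi * _]mulrA !sqrtrM ?mulr_ge0//.
  have s2 : Num.sqrt 2 ^+ 2 = 2 :> R by rewrite sqr_sqrtr.
  have s20 : Num.sqrt 2 != 0 :> R by rewrite gt_eqF ?sqrtr_gt0.
  have sp0 : Num.sqrt pi != 0 :> R by rewrite gt_eqF ?sqrtr_gt0 ?pi_gt0.
  have sn0 : Num.sqrt n%:R != 0 :> R by rewrite gt_eqF ?sqrtr_gt0 ?ltr0n.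
  have sT0 : Num.sqrt T%:R != 0 :> R by rewrite gt_eqF ?sqrtr_gt0 ?ltr0n.
  rewrite -[X in X / (eta * _) * _]s2.
  by field; rewrite s20 sp0 sn0 sT0 gt_eqF.
- apply: (le_trans (b2 halpha)); rewrite /K.
  rewrite le_eqVlt; apply/orP; left; apply/eqP; rewrite mulrA; congr (_ * _ * _).
  have q0 : T%:R `^ (1 - alpha) != 0 :> R by rewrite gt_eqF ?powR_gt0 ?ltr0n.
  by field; rewrite q0 !gt_eqF.
- apply: (le_trans (b3 halpha)); rewrite /K.
  rewrite le_eqVlt; apply/orP; left; apply/eqP; rewrite mulrA; congr (_ * _ * _).
  have q0 : T%:R `^ alpha != 0 :> R by rewrite gt_eqF ?powR_gt0 ?ltr0n.
  by field; rewrite q0 !gt_eqF.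
Qed.
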